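(* Let $K$ be a field and let $\Lambda$ be a finite-dimensional symmetric $K$-algebra that is also 2-CY-tilted, i.e. $\Lambda=\operatorname{End}_{\mathcal{C}}(T)$ for some cluster-tilting object $T$ within a triangulated 2-Calabi-Yau category $\mathcal{C}$ with suspension functor $\Sigma$. (a) The functor $\Omega^4$ on the stable module category $\underline{\mathrm{mod}}\,\Lambda$ is isomorphic to the identity; hence all non-projective $\Lambda$-modules are $\Omega$-periodic with period dividing $4$. (b) The functor $\Sigma^2$ acts as the identity on the objects of $\mathcal{C}$ (i.e. $\Sigma^2X\simeq X$ for every object $X$ of $\mathcal{C}$). (c) Assume that $\Lambda$ is a Jacobian algebra of a hyperpotential. Then $\Lambda$ is rigid if and only if $\Lambda$ is semi-simple.
   Context: A 2-Calabi-Yau triangulated category is a $K$-linear, Hom-finite, Krull-Schmidt triangulated category $\mathcal{C}$ with suspension $\Sigma$ and functorial isomorphisms $\operatorname{Hom}_{\mathcal C}(X,Y)\simeq D\operatorname{Hom}_{\mathcal C}(Y,\Sigma^2X)$, where $D=\operatorname{Hom}_K(-,K)$. An object $T$ is cluster-tilting if $\operatorname{add}T=\{X:\operatorname{Hom}_{\mathcal C}(T,\Sigma X)=0\}$. $\Omega$ is the syzygy functor on the stable category of finite-dimensional modules. For a finite quiver $Q$ with completed path algebra $\widehat{KQ}$ (paths written left to right), a hyperpotential on $Q$ is a collection $(\rho_\alpha)_{\alpha\in Q_1}$ of elements of $\widehat{KQ}$, indexed by the arrows, such that $\rho_\alpha$ is a (possibly infinite) combination of paths from the end of $\alpha$ to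 the start of $\alpha$ and $\sum_\alpha(\alpha\rho_\alpha-\rho_\alpha\alpha)=0$; its Jacobian algebra is the quotient of $\widehat{KQ}$ by the closure of the ideal generated by all $\rho_\alpha$. Such a finite-dimensional Jacobian algebra $\Lambda$ is called rigid if $\mathrm{HH}_0(\Lambda)=\Lambda/[\Lambda,\Lambda]$ is spanned by the images of the primitive idempotents corresponding to the vertices of $Q$. *)

(* Defs.v *)
From HB Require Import structures.
From mathcomp Require Import all_boot all_order all_algebra.
From mathcomp Require Import generic_quotient boolp functions.

Set Implicit Arguments.
Unset Strict Implicit.
Unset Printing Implicit Defensive.

Import GRing.Theory.
Local Open Scope quotient_scope.
Local Open Scope ring_scope.

(* Finite-dimensional K-algebras. MathComp's [falgType] excludes the zero      *)
(* algebra, which does occur here, as the endomorphism algebra of a zero      *)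
(* object or as a Jacobian algebra.                                           *)
Record fdalg (K : fieldType) := FdAlg {
  fdvect : vectType K;
  fdmul : fdvect -> fdvect -> fdvect;
  fdone : fdvect;
  fdmulA : associative fdmul;
  fdmul1 : left_id fdone fdmul;
  fd1mul : right_id fdone fdmul;
  fdmul_linearl : forall b, linear (fun a => fdmul a b);
  fdmul_linearr : forall a, linear (fdmul a)
}.

Definition fdcar (K : fieldType) (A : fdalg K) : Type := fdvect A.
Coercion fdcar : fdalg >-> Sortclass.

Section FdAlgTheory.
Variables (K : fieldType) (A : fdalg K).
HB.instance Definition _ := Vector.copy (fdcar A) (fdvect A).

Fact fd_mulDl : left_distributive (@fdmul K A : A -> A -> A) +%R.
Proof.
by move=> f g h; have := fdmul_linearl h 1 f g; rewrite /= !scale1r; apply.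
Qed.
Fact fd_mulDr : right_distributive (@fdmul K A : A -> A -> A) +%R.
Proof.
by move=> h f g; have := fdmul_linearr h 1 f g; rewrite /= !scale1r; apply.
Qed.
HB.instance Definition _ := GRing.Zmodule_isPzRing.Build (fdcar A)
  (@fdmulA K A) (@fdmul1 K A) (@fd1mul K A) fd_mulDl fd_mulDr.

Lemma fd_scaleAl (k : K) (x y : A) : k *: (x * y) = (k *: x) * y.
Proof.
have e : @fdmul K A 0 y = 0 := mul0r (y : A).
by have := fdmul_linearl y k x 0; rewrite e !addr0.
Qed.
Lemma fd_scaleAr (k : K) (x y : A) : k *: (x * y) = x * (k *: y).
Proof.
have e : @fdmul K A x 0 = 0 := mulr0 (x : A).
by have := fdmul_linearr x k y 0; rewrite e !addr0.
Qed.
End FdAlgTheory.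

Definition algebra_iso (K : fieldType) (A B : fdalg K) : Prop :=
  exists f : A -> B, [/\ linear f, monoid_morphism f & bijective f].

(* A isomorphic to D A as a bimodule, where (a.f.b)(y) = f(b y a). *)
Definition symmetric_algebra (K : fieldType) (A : fdalg K) : Prop :=
  exists phi : A -> 'Hom(A, K^o),
    [/\ linear phi, bijective phi &
      forall a x b y, phi (a * x * b) y = phi x (b * y * a)].

Definition right_ideal (K : fieldType) (A : fdalg K) (I : {vspace A}) : Prop :=
  forall a x : A, x \in I -> x * a \in I.

Definition simple_right_ideal (K : fieldType) (A : fdalg K)
    (I : {vspace A}) : Prop :=
  [/\ right_ideal I, I <> 0%VS &
    forall J : {vspace A}, right_ideal J -> (J <= I)%VS -> J = 0%VS \/ J = I].

Definition semisimple_algebra (K : fieldType) (A : fdalg K) : Prop :=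
  exists (n : nat) (S : 'I_n -> {vspace A}),
    [/\ forall i, simple_right_ideal (S i),
        directv (\sum_i S i) & (\sum_i S i)%VS = fullv].

Record category := Category {
  ob :> Type;
  hom : ob -> ob -> Type;
  idm : forall X, hom X X;
  comp : forall X Y Z, hom Y Z -> hom X Y -> hom X Z;
  comp1m : forall X Y (f : hom X Y), comp (idm Y) f = f;
  compm1 : forall X Y (f : hom X Y), comp f (idm X) = f;
  compA : forall W X Y Z (h : hom Y Z) (g : hom X Y) (f : hom W X),
    comp h (comp g f) = comp (comp h g) f
}.
Arguments hom {c} X Y.
Arguments idm {c} X.
Arguments comp {c X Y Z} g f : rename.

Definition is_iso (C : category) (X Y : C) (f : hom X Y) : Prop :=
  exists g : hom Y X, comp g f = idm X /\ comp f g = idm Y.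

Definition isomorphic (C : category) (X Y : C) : Prop :=
  exists f : hom X Y, is_iso f.

Record functor (C D : category) := Functor {
  fob :> C -> D;
  fmap : forall X Y : C, hom X Y -> hom (fob X) (fob Y);
  fmap1 : forall X : C, fmap (idm X) = idm (fob X);
  fmapM : forall (X Y Z : C) (g : hom Y Z) (f : hom X Y),
    fmap (comp g f) = comp (fmap g) (fmap f)
}.
Arguments fmap {C D} F {X Y} f : rename.

Definition functor_id (C : category) : functor C C :=
  {| fob := fun X => X; fmap := fun _ _ f => f;
     fmap1 := fun _ => erefl; fmapM := fun _ _ _ _ _ => erefl |}.

Program Definition functor_comp (C D E : category)
    (G : functor D E) (F : functor C D) : functor C E :=
  {| fob := fun X => G (F X); fmap := fun _ _ f => fmap G (fmap F f) |}.
Next Obligation. by move=> *; rewrite !fmap1. Qed.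
Next Obligation. by move=> *; rewrite !fmapM. Qed.

Fixpoint functor_iter (C : category) (n : nat) (F : functor C C) : functor C C :=
  if n is m.+1 then functor_comp F (functor_iter m F) else functor_id C.

Definition functor_iso (C D : category) (F G : functor C D) : Prop :=
  exists eta : forall X : C, hom (F X) (G X),
    (forall X, is_iso (eta X)) /\
    (forall (X Y : C) (f : hom X Y),
       comp (eta Y) (fmap F f) = comp (fmap G f) (eta X)).

Definition is_equivalence (C D : category) (F : functor C D) : Prop :=
  exists G : functor D C,
    functor_iso (functor_comp G F) (functor_id C) /\
    functor_iso (functor_comp F G) (functor_id D).

(* Hom-finiteness is built in, since a vectType is finite-dimensional.        *)

Record linear_category (K : fieldType) := LinearCategory {
  lob : Type;
  lhom : lob -> lob -> vectType K;
  lidm : forall X, lhom X X;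
  lcomp : forall X Y Z, lhom Y Z -> lhom X Y -> lhom X Z;
  lcomp1m : forall X Y (f : lhom X Y), lcomp (lidm Y) f = f;
  lcompm1 : forall X Y (f : lhom X Y), lcomp f (lidm X) = f;
  lcompA : forall W X Y Z (h : lhom Y Z) (g : lhom X Y) (f : lhom W X),
    lcomp h (lcomp g f) = lcomp (lcomp h g) f;
  lcomp_linearl : forall X Y Z (f : lhom X Y),
    linear (fun g : lhom Y Z => lcomp g f);
  lcomp_linearr : forall X Y Z (g : lhom Y Z),
    linear (fun f : lhom X Y => lcomp g f)
}.
Arguments lhom {K C} X Y : rename.
Arguments lidm {K C} X : rename.
Arguments lcomp {K C X Y Z} g f : rename.

Definition category_of (K : fieldType) (C : linear_category K) : category :=
  {| ob := lob C; hom := fun X Y => lhom X Y; idm := @lidm K C;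
     comp := @lcomp K C; comp1m := @lcomp1m K C; compm1 := @lcompm1 K C;
     compA := @lcompA K C |}.
Coercion category_of : linear_category >-> category.

Notation "g \oc f" := (lcomp g f) (at level 50, left associativity).

Section LinearCategories.
Variables (K : fieldType) (C : linear_category K).
Implicit Types X Y Z T S : C.

(* For I empty this says that S is a zero object. *)
Definition is_biproduct (I : finType) (F : I -> C) S : Prop :=
  exists (inj : forall i, lhom (F i) S) (prj : forall i, lhom S (F i)),
    [/\ forall i, prj i \oc inj i = lidm (F i),
        forall i j, i != j -> prj j \oc inj i = 0 &
        \sum_i (inj i \oc prj i) = lidm S].

Definition is_additive : Prop :=
  forall (I : finType) (F : I -> C), exists S, is_biproduct F S.

Definition has_local_end X : Prop :=
  lidm X <> 0 /\
  forall f g : lhom X X, @is_iso C X X (f + g) -> @is_iso C X X f \/ @is_iso C X X g.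

Definition is_krull_schmidt : Prop :=
  forall X, exists (n : nat) (F : 'I_n -> C),
    (forall i, has_local_end (F i)) /\ is_biproduct F X.

Definition is_zero_object X : Prop := is_biproduct (fun i : 'I_0 => X) X.

(* add T: direct summands of finite direct sums of copies of T *)
Definition in_add T X : Prop :=
  exists (n : nat) (S Y : C),
    is_biproduct (fun _ : 'I_n => T) S /\
    is_biproduct (fun b : bool => if b then X else Y) S.

Definition endalg T : fdalg K :=
  {| fdvect := lhom T T; fdmul := @lcomp K C T T T; fdone := lidm T;
     fdmulA := @lcompA K C T T T T; fdmul1 := @lcomp1m K C T T;
     fd1mul := @lcompm1 K C T T; fdmul_linearl := @lcomp_linearl K C T T T;
     fdmul_linearr := @lcomp_linearr K C T T T |}.

End LinearCategories.

Section Triangulated.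
Variables (K : fieldType) (C : linear_category K).

(* [dist u v w]: X -u-> Y -v-> Z -w-> Sigma X is a distinguished triangle. *)
Definition triangles (Sigma : functor C C) : Type :=
  forall X Y Z : C, lhom X Y -> lhom Y Z -> lhom Z (Sigma X) -> Prop.

Definition fmapl (F : functor C C) (X Y : C) (f : lhom X Y) :
  lhom (F X : C) (F Y : C) := @fmap C C F X Y f.

Record is_triangulated (Sigma : functor C C) (dist : triangles Sigma) : Prop := {
  tri_additive : is_additive C;
  tri_linear : forall X Y : C, linear (@fmapl Sigma X Y);
  tri_equiv : is_equivalence Sigma;
  tri_id : forall X Z : C, is_zero_object Z ->
    @dist X X Z (lidm X) 0 0;
  tri_iso : forall (X Y Z X' Y' Z' : C)
      (u : lhom X Y) (v : lhom Y Z) (w : lhom Z (Sigma X))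
      (u' : lhom X' Y') (v' : lhom Y' Z') (w' : lhom Z' (Sigma X'))
      (f : lhom X X') (g : lhom Y Y') (h : lhom Z Z'),
    @is_iso C _ _ f -> @is_iso C _ _ g -> @is_iso C _ _ h ->
    g \oc u = u' \oc f -> h \oc v = v' \oc g -> fmapl Sigma f \oc w = w' \oc h ->
    dist _ _ _ u v w -> dist _ _ _ u' v' w';
  tri_cone : forall (X Y : C) (u : lhom X Y),
    exists (Z : C) (v : lhom Y Z) (w : lhom Z (Sigma X)), dist _ _ _ u v w;
  tri_rotate : forall (X Y Z : C)
      (u : lhom X Y) (v : lhom Y Z) (w : lhom Z (Sigma X)),
    dist _ _ _ u v w <-> dist _ _ _ v w (- fmapl Sigma u);
  tri_complete : forall (X Y Z X' Y' Z' : C)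
      (u : lhom X Y) (v : lhom Y Z) (w : lhom Z (Sigma X))
      (u' : lhom X' Y') (v' : lhom Y' Z') (w' : lhom Z' (Sigma X'))
      (f : lhom X X') (g : lhom Y Y'),
    dist _ _ _ u v w -> dist _ _ _ u' v' w' -> g \oc u = u' \oc f ->
    exists h : lhom Z Z',
      h \oc v = v' \oc g /\ fmapl Sigma f \oc w = w' \oc h;
  tri_octahedral : forall (X Y Z X' Y' Z' : C)
      (u : lhom X Y) (j : lhom Y Z') (k : lhom Z' (Sigma X))
      (v : lhom Y Z) (l : lhom Z X') (i : lhom X' (Sigma Y))
      (m : lhom Z Y') (n : lhom Y' (Sigma X)),
    dist _ _ _ u j k -> dist _ _ _ v l i -> dist _ _ _ (v \oc u) m n ->
    exists (f : lhom Z' Y') (g : lhom Y' X'),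
      [/\ dist _ _ _ f g (fmapl Sigma j \oc i),
          f \oc j = m \oc v, n \oc f = k,
          g \oc m = l & i \oc g = fmapl Sigma u \oc n]
}.

(* Hom(X, Y) -> D Hom(Y, Sigma^2 X), natural in X and Y *)
Definition has_2CY_duality (Sigma : functor C C) : Prop :=
  exists phi : forall X Y : C, lhom X Y -> 'Hom(@lhom K C Y (Sigma (Sigma X)), K^o),
    [/\ forall X Y, linear (phi X Y),
        forall X Y, bijective (phi X Y) &
        forall (X' X Y Y' : C) (a : lhom X' X) (h : lhom X Y) (b : lhom Y Y')
               (t : lhom Y' (Sigma (Sigma X'))),
          phi X' Y' (b \oc h \oc a) t =
          phi X Y h (fmapl Sigma (fmapl Sigma a) \oc t \oc b)].

Definition is_2CY_triangulated (Sigma : functor C C) (dist : triangles Sigma) :=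
  [/\ is_triangulated dist, is_krull_schmidt C & has_2CY_duality Sigma].

Definition cluster_tilting (Sigma : functor C C) (T : C) : Prop :=
  forall X : C, in_add T X <-> (forall f : lhom T (Sigma X), f = 0).

End Triangulated.

(* Finite-dimensional right modules; [act M a x] is x.a.                      *)
Record fdmod (K : fieldType) (A : fdalg K) := FdMod {
  mcar :> vectType K;
  act : A -> mcar -> mcar;
  act_linearl : forall x, linear (fun a => act a x);
  act_linearr : forall a, linear (act a);
  actM : forall a b x, act (a * b) x = act b (act a x);
  act1 : forall x, act 1 x = x
}.
Arguments act {K A} M a x : rename.

Section LinearHom.
Variables (K : fieldType) (U V : vectType K) (f : U -> V) (f_lin : linear f).
Let F : {linear U -> V} := HB.pack f (GRing.isLinear.Build K U V _ f f_lin).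
Definition lin_hom : 'Hom(U, V) := linfun F.
Lemma lin_homE x : lin_hom x = f x. Proof. exact: (lfunE F). Qed.
End LinearHom.

Section Modules.
Variables (K : fieldType) (A : fdalg K).
Implicit Types M N P Q : fdmod A.

Lemma act0 M a : act M a 0 = 0.
Proof.
have := act_linearr a 1 (0 : M) 0; rewrite !scale1r addr0.
by move/(congr1 (fun z => z - act M a 0)); rewrite addrK subrr => <-.
Qed.
Lemma actD M a x y : act M a (x + y) = act M a x + act M a y.
Proof. by have := act_linearr a 1 x y; rewrite !scale1r. Qed.
Lemma actN M a x : act M a (- x) = - act M a x.
Proof. by apply/eqP; rewrite -subr_eq0 opprK -actD addNr act0. Qed.
Lemma actB M a x y : act M a (x - y) = act M a x - act M a y.
Proof. by rewrite actD actN. Qed.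
Lemma act_sum M a (I : finType) (F : I -> M) :
  act M a (\sum_i F i) = \sum_i act M a (F i).
Proof. by apply: (big_morph (act M a)); [exact: actD | exact: act0]. Qed.

Record modhom M N := ModHom {
  mhval :> 'Hom(M, N);
  _ : `[< forall a x, mhval (act M a x) = act N a (mhval x) >]
}.
HB.instance Definition _ M N := [isSub for @mhval M N].
HB.instance Definition _ M N := [Choice of modhom M N by <:].

Lemma modhomP M N (f : modhom M N) a x : f (act M a x) = act N a (f x).
Proof. by case: f => f /= /asboolP. Qed.

Lemma modhom_eq M N (f g : modhom M N) : (forall x, f x = g x) -> f = g.
Proof. by move=> e; apply/val_inj/lfunP. Qed.

Lemma modhomB M N (f : modhom M N) x y : f (x - y) = f x - f y.
Proof. exact: linearB. Qed.

Section Mk.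
Variables (M N : fdmod A) (f : M -> N).
Hypothesis f_lin : linear f.
Hypothesis f_act : forall a x, f (act M a x) = act N a (f x).
Fact mk_modhom_subproof :
  `[< forall a x, lin_hom f_lin (act M a x) = act N a (lin_hom f_lin x) >].
Proof. by apply/asboolP => a x; rewrite !lin_homE. Qed.
Definition mk_modhom : modhom M N := ModHom mk_modhom_subproof.
Lemma mk_modhomE x : mk_modhom x = f x. Proof. exact: lin_homE. Qed.
End Mk.

Definition mid M : modhom M M :=
  @mk_modhom M M id (fun _ _ _ => erefl) (fun _ _ => erefl).
Lemma midE M x : mid M x = x. Proof. exact: mk_modhomE. Qed.

Fact mcomp_linear M N P (g : modhom N P) (f : modhom M N) :
  linear (fun x => g (f x)).
Proof. by move=> k x y; rewrite !linearP. Qed.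
Fact mcomp_act M N P (g : modhom N P) (f : modhom M N) a x :
  g (f (act M a x)) = act P a (g (f x)).
Proof. by rewrite !modhomP. Qed.
Definition mcomp M N P (g : modhom N P) (f : modhom M N) : modhom M P :=
  mk_modhom (mcomp_linear g f) (mcomp_act g f).
Lemma mcompE M N P (g : modhom N P) (f : modhom M N) x : mcomp g f x = g (f x).
Proof. exact: mk_modhomE. Qed.

Fact msub_linear M N (f g : modhom M N) : linear (fun x => f x - g x).
Proof.
by move=> k x y; rewrite !linearP /= [in RHS]scalerDr addrACA.
Qed.
Fact msub_act M N (f g : modhom M N) a x :
  f (act M a x) - g (act M a x) = act N a (f x - g x).
Proof. by rewrite !modhomP actB. Qed.
Definition msub M N (f g : modhom M N) : modhom M N :=
  mk_modhom (msub_linear f g) (msub_act f g).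
Lemma msubE M N (f g : modhom M N) x : msub f g x = f x - g x.
Proof. exact: mk_modhomE. Qed.

Lemma mcompA M N P Q (h : modhom P Q) (g : modhom N P) (f : modhom M N) :
  mcomp h (mcomp g f) = mcomp (mcomp h g) f.
Proof. by apply: modhom_eq => x; rewrite !mcompE. Qed.
Lemma mcomp1m M N (f : modhom M N) : mcomp (mid N) f = f.
Proof. by apply: modhom_eq => x; rewrite mcompE midE. Qed.
Lemma mcompm1 M N (f : modhom M N) : mcomp f (mid M) = f.
Proof. by apply: modhom_eq => x; rewrite mcompE midE. Qed.

Definition msurjective M N (f : modhom M N) : Prop := forall y, exists x, f x = y.

Definition projective P : Prop :=
  forall M N (q : modhom M N) (f : modhom P N),
    msurjective q -> exists g : modhom P M, mcomp q g = f.

Definition factors_projective M N (f : modhom M N) : Prop :=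
  exists P (u : modhom M P) (v : modhom P N), projective P /\ f = mcomp v u.

Definition stable_eq M N (f g : modhom M N) : bool :=
  `[< factors_projective (msub f g) >].

Section Free.
Variable n : nat.
Notation car := {ffun 'I_n -> A}.
Definition free_act (a : A) (x : car) : car := [ffun i => x i * a].
Fact free_linearl (x : car) : linear (fun a => free_act a x).
Proof. by move=> k a b; apply/ffunP => i; rewrite !ffunE mulrDr fd_scaleAr. Qed.
Fact free_linearr a : linear (free_act a).
Proof. by move=> k x y; apply/ffunP => i; rewrite !ffunE mulrDl fd_scaleAl. Qed.
Fact free_actM a b x : free_act (a * b) x = free_act b (free_act a x).
Proof. by apply/ffunP => i; rewrite !ffunE mulrA. Qed.
Fact free_act1 x : free_act 1 x = x.
Proof. by apply/ffunP => i; rewrite !ffunE mulr1. Qed.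
Definition free_mod : fdmod A :=
  {| mcar := car; act := free_act; act_linearl := free_linearl;
     act_linearr := free_linearr; actM := free_actM; act1 := free_act1 |}.

Variables (M : fdmod A) (v : 'I_n -> M).
Fact free_map_linear : linear (fun x : free_mod => \sum_i act M ((x : car) i) (v i)).
Proof.
move=> k x y; rewrite scaler_sumr -big_split; apply: eq_bigr => i _.
by rewrite !ffunE; apply: act_linearl.
Qed.
Fact free_map_act a (x : free_mod) :
  \sum_i act M ((act free_mod a x : car) i) (v i) =
  act M a (\sum_i act M ((x : car) i) (v i)).
Proof. by rewrite act_sum; apply: eq_bigr => i _; rewrite ffunE actM. Qed.
Definition free_map : modhom free_mod M := mk_modhom free_map_linear free_map_act.
End Free.

Lemma free_mapE n M (v : 'I_n -> M) x :
  free_map v x = \sum_i act M ((x : {ffun _}) i) (v i).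
Proof. exact: mk_modhomE. Qed.

Definition free_gen n (i : 'I_n) : free_mod n := [ffun j => (i == j)%:R].

Lemma free_decomp n (x : free_mod n) :
  x = \sum_i act (free_mod n) ((x : {ffun _}) i) (free_gen i).
Proof.
apply/ffunP => j; rewrite sum_ffunE (bigD1 j) //= !ffunE eqxx mul1r big1 ?addr0//.
by move=> i /negPf ne; rewrite !ffunE ne mul0r.
Qed.

Lemma free_projective n : projective (free_mod n).
Proof.
move=> M N q f q_surj.
pose v i := sval (cid (q_surj (f (free_gen i)))).
have vE i : q (v i) = f (free_gen i) := svalP (cid (q_surj (f (free_gen i)))).
exists (free_map v); apply: modhom_eq => x; rewrite mcompE free_mapE.
rewrite [in RHS](free_decomp x) !linear_sum; apply: eq_bigr => i _ /=.
by rewrite modhomP vE; apply/esym/(modhomP f).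
Qed.

Section DirectSum.
Variables (P Q : fdmod A).
Definition dsum_act (a : A) (x : P * Q) : P * Q := (act P a x.1, act Q a x.2).
Fact dsum_linearl (x : P * Q) : linear (fun a => dsum_act a x).
Proof. by move=> k a b; rewrite /dsum_act !act_linearl. Qed.
Fact dsum_linearr a : linear (dsum_act a).
Proof. by move=> k x y; rewrite /dsum_act !act_linearr. Qed.
Fact dsum_actM a b x : dsum_act (a * b) x = dsum_act b (dsum_act a x).
Proof. by rewrite /dsum_act !actM. Qed.
Fact dsum_act1 x : dsum_act 1 x = x.
Proof. by rewrite /dsum_act !act1; case: x. Qed.
Definition dsum : fdmod A :=
  {| mcar := (P * Q)%type; act := dsum_act; act_linearl := dsum_linearl;
     act_linearr := dsum_linearr; actM := dsum_actM; act1 := dsum_act1 |}.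
End DirectSum.

Section DirectSumMaps.
Variables (P Q N : fdmod A).

Fact to_dsum_linear (f : modhom N P) (g : modhom N Q) :
  linear (fun x => (f x, g x) : dsum P Q).
Proof. by move=> k x y; rewrite !linearP. Qed.
Fact to_dsum_act (f : modhom N P) (g : modhom N Q) a x :
  (f (act N a x), g (act N a x)) = act (dsum P Q) a (f x, g x).
Proof. by rewrite !modhomP. Qed.
Definition to_dsum f g := mk_modhom (to_dsum_linear f g) (to_dsum_act f g).
Lemma to_dsumE f g x : to_dsum f g x = (f x, g x).
Proof. exact: mk_modhomE. Qed.

Fact from_dsum_linear (f : modhom P N) (g : modhom Q N) :
  linear (fun x : dsum P Q => f x.1 + g x.2).
Proof. by move=> k x y; rewrite !linearP scalerDr addrACA. Qed.
Fact from_dsum_act (f : modhom P N) (g : modhom Q N) a (x : dsum P Q) :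
  f (act (dsum P Q) a x).1 + g (act (dsum P Q) a x).2 = act N a (f x.1 + g x.2).
Proof. by rewrite !modhomP actD. Qed.
Definition from_dsum f g := mk_modhom (from_dsum_linear f g) (from_dsum_act f g).
Lemma from_dsumE f g x : from_dsum f g x = f x.1 + g x.2.
Proof. exact: mk_modhomE. Qed.
End DirectSumMaps.

Fact inl_linear P Q : linear (fun x : P => (x, 0) : dsum P Q).
Proof. by move=> k x y; congr (_, _); rewrite /= scaler0 addr0. Qed.
Fact inl_act P Q a (x : P) : (act P a x, 0) = act (dsum P Q) a (x, 0).
Proof. by congr (_, _); rewrite /= act0. Qed.
Definition dsum_inl P Q := mk_modhom (@inl_linear P Q) (@inl_act P Q).
Fact inr_linear P Q : linear (fun x : Q => (0, x) : dsum P Q).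
Proof. by move=> k x y; congr (_, _); rewrite /= scaler0 addr0. Qed.
Fact inr_act P Q a (x : Q) : (0, act Q a x) = act (dsum P Q) a (0, x).
Proof. by congr (_, _); rewrite /= act0. Qed.
Definition dsum_inr P Q := mk_modhom (@inr_linear P Q) (@inr_act P Q).

Lemma dsum_projective P Q : projective P -> projective Q -> projective (dsum P Q).
Proof.
move=> pP pQ M N q f q_surj.
have [g eg] := pP M N q (mcomp f (dsum_inl P Q)) q_surj.
have [h eh] := pQ M N q (mcomp f (dsum_inr P Q)) q_surj.
exists (from_dsum g h); apply: modhom_eq => -[x y].
rewrite mcompE mk_modhomE linearD /= -!mcompE eg eh !mcompE -linearD.
by rewrite !mk_modhomE; congr (f _); congr (_, _); rewrite /= ?addr0 ?add0r.
Qed.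

Lemma factors_sub M N (f g h : modhom M N) :
  factors_projective f -> factors_projective g ->
  (forall x, h x = f x - g x) -> factors_projective h.
Proof.
move=> [P [u [v [pP ef]]]] [Q [u' [v' [pQ eg]]]] eh.
exists (dsum P Q), (to_dsum u u').
pose w := msub (from_dsum v (msub v' v')) (from_dsum (msub v v) v').
exists w; split; first exact: dsum_projective.
apply: modhom_eq => x; rewrite eh ef eg !mcompE msubE !to_dsumE !from_dsumE /=.
by rewrite !msubE !subrr addr0 add0r.
Qed.

Lemma factors_comp M N P Q (f : modhom N P) (g : modhom M N) (h : modhom P Q) :
  factors_projective f -> factors_projective (mcomp h (mcomp f g)).
Proof.
move=> [R [u [v [pR ->]]]]; exists R, (mcomp u g), (mcomp h v); split=> //.
by rewrite !mcompA.
Qed.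

Lemma factors_zero M N (f : modhom M N) :
  (forall x, f x = 0) -> factors_projective f.
Proof.
move=> f0; have e (p : free_mod 0) : p = 0 by apply/ffunP => -[].
have l : linear (fun _ : M => 0 : free_mod 0).
  by move=> k x y; apply: etrans (e _) (esym (e _)).
have l' : linear (fun _ : free_mod 0 => 0 : N).
  by move=> k x y; rewrite addr0 (scaler0 N).
exists (free_mod 0), (@mk_modhom _ _ _ l (fun a x => esym (act0 _ a))),
  (@mk_modhom _ _ _ l' (fun a x => esym (act0 _ a))).
split; first exact: free_projective.
by apply: modhom_eq => x; rewrite f0 mcompE mk_modhomE.
Qed.

Lemma stable_eqP M N (f g : modhom M N) :
  reflect (factors_projective (msub f g)) (stable_eq f g).
Proof. exact: asboolP. Qed.

Lemma stable_eq_refl M N : reflexive (@stable_eq M N).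
Proof.
by move=> f; apply/stable_eqP/factors_zero => x; rewrite msubE subrr.
Qed.

Lemma stable_eq_sym M N : symmetric (@stable_eq M N).
Proof.
suff h f g : stable_eq f g -> @stable_eq M N g f.
  by move=> f g; apply/idP/idP; apply: h.
move=> /stable_eqP fg; apply/stable_eqP.
apply: (factors_sub (f := msub f f) (factors_zero _) fg) => x.
  by rewrite msubE subrr.
by rewrite !msubE subrr sub0r opprB.
Qed.

Lemma stable_eq_trans M N : transitive (@stable_eq M N).
Proof.
move=> g f h /stable_eqP fg; rewrite stable_eq_sym => /stable_eqP hg.
apply/stable_eqP; apply: (factors_sub fg hg) => x.
by rewrite !msubE opprB addrA subrK.
Qed.

Lemma stable_eq_comp M N P (g g' : modhom N P) (f f' : modhom M N) :
  stable_eq g g' -> stable_eq f f' -> stable_eq (mcomp g f) (mcomp g' f').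
Proof.
move=> /stable_eqP eg /stable_eqP ef.
apply: (@stable_eq_trans _ _ (mcomp g' f)); apply/stable_eqP.
  have -> : msub (mcomp g f) (mcomp g' f) = mcomp (mid P) (mcomp (msub g g') f).
    by apply: modhom_eq => x; rewrite mcomp1m !(msubE, mcompE).
  exact: factors_comp.
have -> : msub (mcomp g' f) (mcomp g' f') =
          mcomp g' (mcomp (msub f f') (mid M)).
  by apply: modhom_eq => x; rewrite mcompm1 !(msubE, mcompE) modhomB.
exact: factors_comp.
Qed.

Definition stable_equiv M N : equiv_rel (modhom M N) :=
  EquivRel (@stable_eq M N) (@stable_eq_refl M N) (@stable_eq_sym M N)
    (@stable_eq_trans M N).

Definition stable_hom M N : Type := {eq_quot (stable_equiv M N)}.
HB.instance Definition _ M N := EqQuotient.on (stable_hom M N).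

Definition stable_class M N (f : modhom M N) : stable_hom M N :=
  \pi_(stable_hom M N) f.
Definition stable_rep M N (f : stable_hom M N) : modhom M N := repr f.

Lemma stable_repK M N (f : stable_hom M N) : stable_class (stable_rep f) = f.
Proof. exact: reprK. Qed.

Lemma stable_classP M N (f g : modhom M N) :
  stable_class f = stable_class g <-> stable_eq f g.
Proof. by split=> [/eqmodP|h]; [|apply/eqmodP]. Qed.

Lemma stable_rep_eq M N (f : modhom M N) : stable_eq (stable_rep (stable_class f)) f.
Proof. by apply/stable_classP; rewrite stable_repK. Qed.

Definition stable_comp M N P (g : stable_hom N P) (f : stable_hom M N) :
  stable_hom M P := stable_class (mcomp (stable_rep g) (stable_rep f)).

Lemma stable_compE M N P (g : modhom N P) (f : modhom M N) :
  stable_comp (stable_class g) (stable_class f) = stable_class (mcomp g f).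
Proof. by apply/stable_classP/stable_eq_comp; apply: stable_rep_eq. Qed.

Fact stable_comp1m M N (f : stable_hom M N) :
  stable_comp (stable_class (mid N)) f = f.
Proof. by rewrite -[f]stable_repK stable_compE mcomp1m. Qed.
Fact stable_compm1 M N (f : stable_hom M N) :
  stable_comp f (stable_class (mid M)) = f.
Proof. by rewrite -[f]stable_repK stable_compE mcompm1. Qed.
Fact stable_compA M N P Q
    (h : stable_hom P Q) (g : stable_hom N P) (f : stable_hom M N) :
  stable_comp h (stable_comp g f) = stable_comp (stable_comp h g) f.
Proof.
by rewrite -[h]stable_repK -[g]stable_repK -[f]stable_repK !stable_compE mcompA.
Qed.

Definition stable_category : category :=
  {| ob := fdmod A; hom := stable_hom; idm := fun M => stable_class (mid M);
     comp := stable_comp; comp1m := stable_comp1m; compm1 := stable_compm1;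
     compA := stable_compA |}.

Section Kernel.
Variables (P M : fdmod A) (p : modhom P M).
Notation car := (subvs_of (lker p)).
Definition ker_act (a : A) (x : car) : car := vsproj (lker p) (act P a (vsval x)).
Lemma ker_actE a x : vsval (ker_act a x) = act P a (vsval x).
Proof.
rewrite vsprojK // memv_ker modhomP.
by move: (subvsP x); rewrite memv_ker => /eqP ->; rewrite act0.
Qed.
Fact ker_linearl (x : car) : linear (fun a => ker_act a x).
Proof.
by move=> k a b; apply: subvs_inj; rewrite linearP /= !ker_actE; apply: act_linearl.
Qed.
Fact ker_linearr a : linear (ker_act a).
Proof.
by move=> k x y; apply: subvs_inj; rewrite linearP /= !ker_actE linearP; apply: act_linearr.
Qed.
Fact ker_actM a b x : ker_act (a * b) x = ker_act b (ker_act a x).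
Proof. by apply: subvs_inj; rewrite !ker_actE actM. Qed.
Fact ker_act1 x : ker_act 1 x = x.
Proof. by apply: subvs_inj; rewrite ker_actE act1. Qed.
Definition ker_mod : fdmod A :=
  {| mcar := car; act := ker_act; act_linearl := ker_linearl;
     act_linearr := ker_linearr; actM := ker_actM; act1 := ker_act1 |}.
Fact ker_incl_linear : linear (vsval : car -> P).
Proof. by move=> k x y; rewrite linearP. Qed.
Definition ker_incl : modhom ker_mod P :=
  @mk_modhom ker_mod P vsval ker_incl_linear ker_actE.
Lemma ker_inclE x : ker_incl x = vsval (x : car). Proof. exact: mk_modhomE. Qed.

Lemma ker_inclP x : p (ker_incl x) = 0.
Proof.
by rewrite ker_inclE; move: (subvsP x); rewrite memv_ker => /eqP.
Qed.

Lemma ker_incl_inj x y : ker_incl x = ker_incl y -> x = y.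
Proof. by rewrite !ker_inclE => /subvs_inj. Qed.

Lemma ker_factor N (f : modhom N P) :
  (forall x, p (f x) = 0) -> exists g : modhom N ker_mod, mcomp ker_incl g = f.
Proof.
move=> pf0; pose g x : car := vsproj (lker p) (f x).
have gE x : vsval (g x) = f x by rewrite vsprojK // memv_ker pf0.
have g_lin : linear g.
  by move=> k x y; apply: subvs_inj; rewrite linearP /= !gE linearP.
have g_act a x : g (act N a x) = act ker_mod a (g x).
  by apply: subvs_inj; rewrite ker_actE !gE modhomP.
exists (@mk_modhom N ker_mod g g_lin g_act); apply: modhom_eq => x.
by rewrite mcompE ker_inclE mk_modhomE gE.
Qed.
End Kernel.

End Modules.

(* A choice, for each module, of a surjection onto it from a projective       *)
(* (for instance of a projective cover). Up to isomorphism, the functor       *)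
(* [syzygy_functor] on the stable category does not depend on it.             *)
Record presentations (K : fieldType) (A : fdalg K) := Presentations {
  pres_obj : fdmod A -> fdmod A;
  pres_map : forall M, modhom (pres_obj M) M;
  pres_projective : forall M, projective (pres_obj M);
  pres_surjective : forall M, msurjective (pres_map M)
}.

Section Syzygy.
Variables (K : fieldType) (A : fdalg K).
Implicit Types M N : fdmod A.

Fact basis_surjective M :
  msurjective (free_map (fun i : 'I_(\dim {:M}) => (vbasis {:M})`_i)).
Proof.
move=> y; exists ([ffun i => coord (vbasis {:M}) i y *: (1 : A)] : {ffun _ -> A}).
rewrite free_mapE {2}(coord_vbasis (memvf y)); apply: eq_bigr => i _.
rewrite ffunE; set v := _`_i; set k := coord _ _ _.
have := act_linearl v k 1 0; rewrite !addr0 => ->.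
have := act_linearl v 1 0 0; rewrite !addr0 !scale1r act1.
by move/(congr1 (fun z => z - act M 0 v)); rewrite addrK subrr => <-; rewrite addr0.
Qed.

Definition free_presentations : presentations A :=
  {| pres_obj := fun M => free_mod A (\dim {:M});
     pres_map := fun M => free_map (fun i => (vbasis {:M})`_i);
     pres_projective := fun M => @free_projective K A _;
     pres_surjective := basis_surjective |}.

Variable S : presentations A.

Definition syzygy M : fdmod A := ker_mod (pres_map S M).

(* h is induced on kernels by a lift g of f along the presentations *)
Definition syzygy_lift M N (f : modhom M N) (h : modhom (syzygy M) (syzygy N)) :=
  exists g : modhom (pres_obj S M) (pres_obj S N),
    mcomp (pres_map S N) g = mcomp f (pres_map S M) /\
    mcomp (ker_incl (pres_map S N)) h = mcomp g (ker_incl (pres_map S M)).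

Lemma syzygy_lift_ex M N (f : modhom M N) : exists h, syzygy_lift f h.
Proof.
have [g eg] := pres_projective (mcomp f (pres_map S M)) (@pres_surjective _ _ S N).
have [x|h eh] := @ker_factor _ _ _ _ (pres_map S N) _ (mcomp g (ker_incl (pres_map S M))).
  by rewrite mcompE -[LHS]mcompE eg mcompE ker_inclP linear0.
by exists h, g.
Qed.

Lemma syzygy_lift_stable M N (f f' : modhom M N) h h' :
  stable_eq f f' -> syzygy_lift f h -> syzygy_lift f' h' -> stable_eq h h'.
Proof.
move=> /stable_eqP [Q [u [v [pQ e]]]] [g [eg eh]] [g' [eg' eh']].
have [w ew] := pQ _ _ (pres_map S N) v (@pres_surjective _ _ S N).
pose t := msub (msub g g') (mcomp w (mcomp u (pres_map S M))).
have [x|s es] := @ker_factor _ _ _ _ (pres_map S N) _ t.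
  rewrite /t !(msubE, mcompE) !modhomB -!(mcompE (pres_map S N)) eg eg' ew.
  by rewrite !mcompE -(mcompE v) -e msubE subrr.
apply/stable_eqP; exists (pres_obj S M), (ker_incl (pres_map S M)), s.
split; first exact: pres_projective.
apply: modhom_eq => x; apply: ker_incl_inj; rewrite msubE modhomB -!mcompE eh eh'.
rewrite mcompA es !mcompE /t !(msubE, mcompE) ker_inclP.
by rewrite (linear0 u) (linear0 w) subr0.
Qed.

Definition syzygy_map M N (f : stable_hom M N) : stable_hom (syzygy M) (syzygy N) :=
  stable_class (sval (cid (syzygy_lift_ex (stable_rep f)))).

Lemma syzygy_mapE M N (f : modhom M N) h :
  syzygy_lift f h -> syzygy_map (stable_class f) = stable_class h.
Proof.
move=> fh; apply/stable_classP; rewrite /syzygy_map; case: cid => h' /= fh'.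
exact: syzygy_lift_stable (stable_rep_eq f) fh' fh.
Qed.

Fact syzygy_map1 M :
  syzygy_map (stable_class (mid M)) = stable_class (mid (syzygy M)).
Proof.
by apply: syzygy_mapE; exists (mid _); rewrite !(mcomp1m, mcompm1).
Qed.

Fact syzygy_mapM M N P (g : stable_hom N P) (f : stable_hom M N) :
  syzygy_map (stable_comp g f) = stable_comp (syzygy_map g) (syzygy_map f).
Proof.
rewrite -[g]stable_repK -[f]stable_repK; set g' := stable_rep g.
set f' := stable_rep f.
have [h' gh] := syzygy_lift_ex g'; have [h fh] := syzygy_lift_ex f'.
rewrite stable_compE (syzygy_mapE gh) (syzygy_mapE fh) stable_compE.
apply: syzygy_mapE; case: gh fh => [k' [e1 e2]] [k [e3 e4]].
exists (mcomp k' k); split.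
  by rewrite mcompA e1 -mcompA e3 mcompA.
by rewrite mcompA e2 -!mcompA e4.
Qed.

Definition syzygy_functor : functor (stable_category A) (stable_category A) :=
  @Functor (stable_category A) (stable_category A)
    syzygy syzygy_map syzygy_map1 syzygy_mapM.

(* [isomorphic] is meant in the stable category.                              *)
Definition has_syzygy_period M (r : nat) : Prop :=
  let Omega := fun n (N : stable_category A) => functor_iter n syzygy_functor N in
  [/\ (0 < r)%N, isomorphic (Omega r M) (M : stable_category A) &
    forall n, (0 < n)%N -> isomorphic (Omega n M) (M : stable_category A) ->
      (r <= n)%N].

End Syzygy.

Record quiver := Quiver {
  vertex : finType;
  arrow : finType;
  source : arrow -> vertex;
  target : arrow -> vertex
}.

Section Paths.
Variable Q : quiver.
Implicit Types (x : vertex Q) (s : seq (arrow Q)).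

Fixpoint is_walk x s : bool :=
  if s is a :: s' then (source a == x) && is_walk (target a) s' else true.

Definition walk_end x s : vertex Q := last x (map (@target Q) s).

Lemma is_walk_cat x s t :
  is_walk x (s ++ t) = is_walk x s && is_walk (walk_end x s) t.
Proof. by elim: s x => //= a s IH x; rewrite IH andbA. Qed.

Lemma walk_end_cat x s t : walk_end x (s ++ t) = walk_end (walk_end x s) t.
Proof. by rewrite /walk_end map_cat last_cat. Qed.

(* The start vertex, followed by the arrows from left to right *)
Record qpath := QPath {
  qpval :> vertex Q * seq (arrow Q);
  _ : is_walk qpval.1 qpval.2
}.
HB.instance Definition _ := [isSub for qpval].
HB.instance Definition _ := [Choice of qpath by <:].

Definition path_start (p : qpath) : vertex Q := p.1.
Definition path_end (p : qpath) : vertex Q := walk_end p.1 p.2.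
Definition path_length (p : qpath) : nat := size p.2.

Definition trivial_path x : qpath := @QPath (x, [::]) isT.

Fact arrow_path_subproof (a : arrow Q) : is_walk (source a) [:: a].
Proof. by rewrite /= eqxx. Qed.
Definition arrow_path (a : arrow Q) : qpath :=
  @QPath (source a, [:: a]) (arrow_path_subproof a).

Fact path_split_subproof (p : qpath) i :
  is_walk p.1 (take i p.2) && is_walk (walk_end p.1 (take i p.2)) (drop i p.2).
Proof. by rewrite -is_walk_cat cat_take_drop; case: p. Qed.
Definition path_take i (p : qpath) : qpath :=
  @QPath (p.1, take i p.2) (proj1 (andP (path_split_subproof p i))).
Definition path_drop i (p : qpath) : qpath :=
  @QPath (walk_end p.1 (take i p.2), drop i p.2)
    (proj2 (andP (path_split_subproof p i))).
End Paths.

Section CompletedPathAlgebra.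
Variables (K : fieldType) (Q : quiver).
Implicit Types (p q : qpath Q).

(* A (possibly infinite) combination of paths is given by its coefficients.   *)
Definition completed_path_algebra : Type := qpath Q -> K^o.
Notation KQ := completed_path_algebra.
HB.instance Definition _ := GRing.Lmodule.copy KQ (qpath Q -> K^o).
Implicit Types (f g h : KQ).

Definition path_mul f g : KQ := fun p =>
  \sum_(i < (path_length p).+1) f (path_take i p) * g (path_drop i p).

Definition path_one : KQ := fun p => (path_length p == 0%N)%:R.

Lemma qpath_eq p q : p.1 = q.1 -> p.2 = q.2 -> p = q.
Proof.
by case: p q => [[x s] w] [[y t] w'] /= e1 e2; apply/val_inj; rewrite /= e1 e2.
Qed.

Lemma path_lengthT i p :
  (i <= path_length p)%N -> path_length (path_take i p) = i.
Proof. by rewrite /path_length size_take_min => /minn_idPl. Qed.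

Lemma path_lengthD i p : path_length (path_drop i p) = (path_length p - i)%N.
Proof. by rewrite /path_length size_drop. Qed.

Lemma path_takeT i k p : (i <= k)%N -> path_take i (path_take k p) = path_take i p.
Proof. by move=> ik; apply: qpath_eq => //=; rewrite take_takel. Qed.

Lemma path_dropT i k p : (i <= k)%N ->
  path_drop i (path_take k p) = path_take (k - i) (path_drop i p).
Proof.
by move=> ik; apply: qpath_eq => /=; rewrite ?take_takel // take_drop subnK.
Qed.

Lemma path_dropD i j p : path_drop j (path_drop i p) = path_drop (j + i) p.
Proof.
apply: qpath_eq => /=; last by rewrite drop_drop.
by rewrite -walk_end_cat addnC takeD.
Qed.

Lemma path_mulE f g p : path_mul f g p =
  \sum_(0 <= i < (path_length p).+1) f (path_take i p) * g (path_drop i p).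
Proof. by rewrite big_mkord. Qed.

Fact path_mulA : associative path_mul.
Proof.
move=> f g h; apply: funext => p; rewrite !path_mulE; set n := path_length p.
pose F i k := f (path_take i p) * g (path_take (k - i) (path_drop i p)) *
              h (path_drop k p).
transitivity (\sum_(0 <= i < n.+1) \sum_(0 <= k < n.+1 | (i <= k)%N) F i k).
  apply: eq_big_nat => i /andP[_ ltin]; rewrite path_mulE path_lengthD mulr_sumr.
  rewrite -(big_nat_widenl i 0 n.+1 predT) // -[X in _ = \sum_(X <= _ < _) _]add0n.
  rewrite big_addn -/n subSn //; apply: eq_big_nat => j _.
  by rewrite path_dropD /F mulrA addnK.
rewrite (exchange_big_dep_nat predT) //=; apply: eq_big_nat => k /andP[_ ltkn].
rewrite path_mulE path_lengthT // mulr_suml (big_nat_widen 0 k.+1 n.+1) //=.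
rewrite [RHS]big_nat_cond [LHS]big_nat_cond; apply: eq_big => i.
  by rewrite ltnS.
by case/andP=> _ leik; rewrite path_takeT // path_dropT.
Qed.

Fact path_mul1 : left_id path_one path_mul.
Proof.
move=> f; apply: funext => p; rewrite path_mulE big_nat_recl //= big1_seq ?addr0.
  rewrite /path_one path_lengthT // mul1r; congr f.
  by apply: qpath_eq => /=; rewrite ?take0 ?drop0.
move=> i; rewrite mem_index_iota => /andP[_ /andP[_ lti]].
by rewrite /path_one path_lengthT // mul0r.
Qed.

Fact path_1mul : right_id path_one path_mul.
Proof.
move=> f; apply: funext => p; rewrite path_mulE big_nat_recr //= big1_seq ?add0r.
  rewrite /path_one path_lengthD subnn mulr1; congr f.
  by apply: qpath_eq => //=; rewrite take_size.
move=> i; rewrite mem_index_iota => /andP[_ /andP[_ lti]].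
by rewrite /path_one path_lengthD subn_eq0 leqNgt lti mulr0.
Qed.

Fact path_mulDl : left_distributive path_mul +%R.
Proof.
move=> f g h; apply: funext => p.
rewrite [RHS](_ : _ = path_mul f h p + path_mul g h p) //.
by rewrite -big_split; apply: eq_bigr => i _; apply: mulrDl.
Qed.

Fact path_mulDr : right_distributive path_mul +%R.
Proof.
move=> f g h; apply: funext => p.
rewrite [RHS](_ : _ = path_mul f g p + path_mul f h p) //.
by rewrite -big_split; apply: eq_bigr => i _; apply: mulrDr.
Qed.

HB.instance Definition _ := GRing.Zmodule_isPzRing.Build KQ
  path_mulA path_mul1 path_1mul path_mulDl path_mulDr.

Definition path_elt (q : qpath Q) : KQ := fun p => (p == q)%:R.
Definition vertex_idem (x : vertex Q) : KQ := path_elt (trivial_path x).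
Definition arrow_elt (a : arrow Q) : KQ := path_elt (arrow_path a).

Definition is_hyperpotential (rho : arrow Q -> KQ) : Prop :=
  (forall a p, rho a p != 0 ->
     path_start p = target a /\ path_end p = source a) /\
  \sum_a (arrow_elt a * rho a - rho a * arrow_elt a) = 0.

Definition in_generated_ideal (rho : arrow Q -> KQ) (z : KQ) : Prop :=
  exists (n : nat) (a : 'I_n -> arrow Q) (x y : 'I_n -> KQ),
    z = \sum_i x i * rho (a i) * y i.

(* Closure for the adic topology of the arrow ideal, whose n-th power         *)
(* consists of the elements vanishing on all paths of length < n.             *)
Definition in_jacobian_ideal (rho : arrow Q -> KQ) (z : KQ) : Prop :=
  forall n, exists w, in_generated_ideal rho w /\
    forall p, (path_length p < n)%N -> z p = w p.

(* phi identifies A with the quotient of KQ by the closed ideal *)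
Definition jacobian_presentation (rho : arrow Q -> KQ) (A : fdalg K)
    (phi : KQ -> A) : Prop :=
  [/\ linear phi, monoid_morphism phi,
      forall b, exists z, phi z = b &
      forall z, phi z = 0 <-> in_jacobian_ideal rho z].

(* A / [A, A] is spanned by the classes of the vertex idempotents *)
Definition rigid (A : fdalg K) (phi : KQ -> A) : Prop :=
  forall b : A, exists (c : vertex Q -> K) (n : nat) (x y : 'I_n -> A),
    b = \sum_v c v *: phi (vertex_idem v) + \sum_i (x i * y i - y i * x i).

End CompletedPathAlgebra.

(* Main.v *)
(* Let lam be a symmetrizing form on End T. The 2-Calabi-Yau pairing of        *)
(* Hom(T, T) with Hom(T, Sigma^2 T) turns lam into g : T -> Sigma^2 T such     *)
(* that g a = Sigma^2(a) g, because lam is a trace, and Hom(T, g) is           *)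
(* bijective, because lam is nondegenerate; the cone of g then vanishes. So    *)
(* Sigma^2 is the identity on add T, and X = Sigma^2 X follows from a triangle *)
(* W1 -> W0 -> X -> Sigma W1 with W1 and W0 in add T.                          *)
(*   Let F = Hom(T, -). Since Hom(Sigma T, T) = 0, such a triangle over        *)
(* Sigma Y gives an exact sequence 0 -> F Y -> F W1 -> F W0 -> F Sigma Y -> 0, *)
(* functorial in Y, so Omega^4 F(Sigma^2 Z) is stably F Z, which is naturally  *)
(* F(Sigma^2 Z) by t |-> Sigma^2(t) g; and F is full and essentially           *)
(* surjective.                                                                 *)
(*   In (c), the arrows generate a nilpotent ideal I. If A is semisimple then  *)
(* I = 0 and the vertex idempotents span A. If A is rigid then I lies in       *)
(* [A, A], so lam vanishes on the ideal I and I = 0.                           *)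
Require Import Defs.
From HB Require Import structures.
From mathcomp Require Import all_boot all_order all_algebra.
From mathcomp Require Import boolp.

Set Implicit Arguments.
Unset Strict Implicit.
Unset Printing Implicit Defensive.

Import GRing.Theory Defs.
Local Open Scope ring_scope.

(** Parts (a) and (b) rest on [double_susp_iso]: the symmetrizing form on End T yields an
    isomorphism from T to its double suspension that is compatible with all endomorphisms of T.
    [double_susp_in_add] spreads it over add T. Then (b) follows from [dist_iso], applied to a
    triangle of [cluster_tilting_triangle] over X and its double suspension.

    For (a), write F for Hom(T, -). By [hom_susp_tilting], F is exact also at the left end of a
    triangle Y -> W1 -> W0 -> Sigma Y with W1, W0 in add T, so F Y is a second syzygy of F(Sigma Y)
    ([tilting_sq1], [tilting_sq2]), and a morphism f induces F f on it ([tilting_lift]). Splicing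
    two such steps and identifying F(Sigma^2 Z) with F Z gives every module M an exact sequence with
    four projectives that begins and ends with M, along which each module map lifts to itself
    ([tilting_r4_lift]). Induced maps on syzygies are unique up to stable equality
    ([sq_lift_stable]), so this sequence may be compared with the one defining Omega^4
    ([syzygy_periodic4]).

    For (c), the arrows generate a nilpotent ideal ([arrow_ideal_vanishes]) modulo which the algebra
    is spanned by orthogonal idempotents. Semisimplicity and, through the trace form, rigidity both
    amount to the vanishing of this ideal. *)

Lemma vspace_of_pred (K : fieldType) (V : vectType K) (P : V -> Prop) :
  P 0 -> (forall k x y, P x -> P y -> P (k *: x + y)) ->
  exists U : {vspace V}, forall x, x \in U <-> P x.
Proof.
move=> P0 Plin.
pose b n := `[< exists U : {vspace V}, \dim U = n /\ forall x, x \in U -> P x >].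
have exb : exists n, b n.
  exists 0%N; apply/asboolP; exists 0%VS; rewrite dimv0; split=> // x.
  by rewrite memv0 => /eqP->.
have bb n : b n -> (n <= \dim {:V})%N.
  by move=> /asboolP[U [<- _]]; apply: dimvS; apply: subvf.
(* A subspace of largest dimension inside [P] is all of [P], since adjoining a further vector would
   enlarge it. *)
case: (ex_maxnP exb bb) => n /asboolP[U [dU UP]] maxn; exists U => x; split; first exact: UP.
move=> Px; suff -> : U = (U + <[x]>)%VS by apply: (subvP (addvSr _ _)); apply: memv_line.
apply/eqP; rewrite eqEdim addvSl dU; apply: maxn; apply/asboolP; eexists; split; first by [].
move=> y /memv_addP[u uU [w /vlineP[k ->] ->]]; rewrite addrC.
by apply: Plin => //; apply: UP.
Qed.

(** * Symmetrizing forms *)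

Section SymmetrizingForm.
Variables (K : fieldType) (A : fdalg K).

(** The form is the image of 1 under the bimodule isomorphism: the left and right actions give
    [phi x y = lam (x * y) = lam (y * x)]. Nondegeneracy and representability are the two halves of
    the bijectivity of [phi]. *)
Lemma symmetric_form : symmetric_algebra A -> exists lam : 'Hom(A, K^o),
  [/\ forall x y : A, lam (x * y) = lam (y * x),
      forall x : A, (forall y : A, lam (x * y) = 0) -> x = 0 &
      forall f : 'Hom(A, K^o), exists a : A, forall x : A, f x = lam (a * x)].
Proof.
move=> [phi [phil [psi phiK psiK] phib]]; exists (phi 1).
have e1 x y : phi x y = phi 1 (x * y).
  by have := phib 1 1 x y; rewrite !mul1r mulr1.
have e2 x y : phi x y = phi 1 (y * x).
  by have := phib x 1 1 y; rewrite !mul1r !mulr1.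
have phi0 : phi 0 = 0.
  by have := phil (-1) 0 0; rewrite scaler0 addr0 scaleN1r addNr.
split=> [x y|x h|f]; first by rewrite -e1 e2.
  apply: (can_inj phiK); rewrite phi0; apply/lfunP => y.
  by rewrite e1 h lfunE.
by exists (psi f) => x; rewrite -e1 psiK.
Qed.
End SymmetrizingForm.

(** * Jacobian algebras *)

Section ArrowIdeal.
Variables (K : fieldType) (Q : quiver).
Local Notation KQ := (completed_path_algebra K Q).

Definition in_arrow_ideal (n : nat) (z : KQ) : Prop :=
  forall p, (path_length p < n)%N -> z p = 0.

Lemma path_algebra_mulE (f g : KQ) p :
  (f * g) p = \sum_(i < (path_length p).+1) f (path_take i p) * g (path_drop i p).
Proof. by []. Qed.

(** However a path of length less than [m + n] is cut in two, the first piece is shorter than [m] or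
    the second is shorter than [n]. *)
Lemma arrow_idealM m n (f g : KQ) :
  in_arrow_ideal m f -> in_arrow_ideal n g -> in_arrow_ideal (m + n) (f * g).
Proof.
move=> hf hg p lp; rewrite path_algebra_mulE big1 // => i _.
case: (ltnP i m) => im.
  by rewrite hf ?mul0r // path_lengthT // -ltnS.
by rewrite hg ?mulr0 // path_lengthD ltn_subLR;
  [apply: leq_trans lp _; rewrite leq_add2r | rewrite -ltnS].
Qed.

Lemma arrow_ideal0 (f : KQ) : in_arrow_ideal 0 f. Proof. by []. Qed.

Lemma arrow_ideal_linear n k (f g : KQ) :
  in_arrow_ideal n f -> in_arrow_ideal n g -> in_arrow_ideal n (k *: f + g).
Proof.
move=> hf hg p lp; rewrite [LHS](_ : _ = k * f p + g p) //.
by rewrite hf // hg // mulr0 addr0.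
Qed.

Lemma path_algebra_sumE (F : vertex Q -> KQ) p : (\sum_v F v) p = \sum_v F v p.
Proof. by elim/big_rec2: _ => // v x y _ <-. Qed.

Lemma path_algebra_subE (f g : KQ) p : (f - g) p = f p - g p.
Proof. by []. Qed.

Lemma arrow_ideal_decomp (z : KQ) :
  in_arrow_ideal 1 (z - \sum_v (z (trivial_path v) : K) *: vertex_idem K v).
Proof.
move=> p; rewrite ltnS leqn0 => /nilP pn.
have pE : p = trivial_path p.1 by apply: qpath_eq.
rewrite path_algebra_subE path_algebra_sumE (bigD1 p.1) //=.
have coefE v : ((z (trivial_path v) : K) *: vertex_idem K v) p =
    z (trivial_path v) * (p == trivial_path v)%:R by [].
rewrite coefE -pE eqxx mulr1 big1 ?addr0 ?subrr // => v vp.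
rewrite coefE (_ : (p == _) = false) ?mulr0 //.
by apply/eqP => e; move: vp; rewrite e eqxx.
Qed.

Lemma vertex_idemM (v w : vertex Q) :
  vertex_idem K v * vertex_idem K w = (v == w)%:R *: vertex_idem K v.
Proof.
apply: funext => p; rewrite -[RHS]/((v == w)%:R * (p == trivial_path v)%:R).
rewrite path_algebra_mulE.
case: (eqVneq (path_length p) 0%N) => [p0|pn0]; last first.
  have -> : (p == trivial_path v) = false by apply/eqP => e; move: pn0; rewrite e.
  rewrite mulr0 big1 // => i _.
  rewrite -[LHS]/((path_take i p == trivial_path v)%:R *
    (path_drop i p == trivial_path w)%:R).
  case: eqP => [ei|_]; last by rewrite mul0r.
  case: eqP => [ej|_]; last by rewrite mulr0.
  have := path_lengthT (ltnSE (ltn_ord i)); rewrite ei => i0.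
  have := path_lengthD i p; rewrite ej -i0 subn0 => h.
  by rewrite -h in pn0.
rewrite p0 big_ord1.
rewrite -[LHS]/((path_take 0 p == trivial_path v)%:R *
  (path_drop 0 p == trivial_path w)%:R).
have pE : p = trivial_path p.1 by apply: qpath_eq => //; apply/nilP/eqP.
have -> : path_take 0 p = p by rewrite pE; apply: qpath_eq.
have -> : path_drop 0 p = p by rewrite pE; apply: qpath_eq.
rewrite -!natrM !mulnb; congr (_%:R); congr nat_of_bool.
apply/andP/andP => [[/eqP a /eqP b]|[/eqP <- ->//]].
have : trivial_path v = trivial_path w by rewrite -a -b.
by move/(congr1 (fun q : qpath Q => q.1)) => /= ->; rewrite b.
Qed.

End ArrowIdeal.

(** * The arrow ideal in a finite-dimensional Jacobian algebra *)

Section JacobianQuotient.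
Variables (K : fieldType) (A : fdalg K) (Q : quiver).
Local Notation KQ := (completed_path_algebra K Q).
Variables (rho : arrow Q -> KQ) (phi : KQ -> A).
Hypothesis phiP : jacobian_presentation rho phi.

Let phi_linear : linear phi. Proof. by case: phiP. Qed.
Let phiM x y : phi (x * y) = phi x * phi y.
Proof. by case: phiP => _ [? h] _ _; apply: h. Qed.
Let phi1 : phi 1 = 1. Proof. by case: phiP => _ []. Qed.
Let phi0 : phi 0 = 0.
Proof. by have := phi_linear (-1) 0 0; rewrite scaler0 addr0 scaleN1r addNr. Qed.
Let phiD x y : phi (x + y) = phi x + phi y.
Proof. by have := phi_linear 1 x y; rewrite !scale1r. Qed.
Let phiZ k x : phi (k *: x) = k *: phi x.
Proof. by have := phi_linear k x 0; rewrite phi0 !addr0. Qed.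
Let phi_surj b : exists z, phi z = b. Proof. by case: phiP. Qed.
Let phi_sum (I : finType) (F : I -> KQ) : phi (\sum_i F i) = \sum_i phi (F i).
Proof. by apply: (big_morph phi). Qed.

Definition in_arrow_image (n : nat) (x : A) : Prop :=
  exists z, in_arrow_ideal n z /\ phi z = x.

Lemma arrow_image_space : exists U : nat -> {vspace A},
  forall n x, x \in U n <-> in_arrow_image n x.
Proof.
suff h n : exists U : {vspace A}, forall x, x \in U <-> in_arrow_image n x.
  by exists (fun n => sval (cid (h n))) => n; apply: (svalP (cid (h n))).
apply: vspace_of_pred => [|k x y [z [mz <-]] [t [mt <-]]]; first by exists 0.
by exists (k *: z + t); split; [exact: arrow_ideal_linear | rewrite phi_linear].
Qed.

(* The images of the powers of the arrow ideal stabilise, by finite dimension; *)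
(* the stable value is 0 because the Jacobian ideal is closed.                 *)
Lemma arrow_ideal_vanishes : exists N, forall z, in_arrow_ideal N z -> phi z = 0.
Proof.
have [U UP] := arrow_image_space.
have mono m n : (m <= n)%N -> (U n <= U m)%VS.
  move=> le; apply/subvP => x /UP[z [mz <-]]; apply/UP; exists z; split=> // p lp.
  by apply: mz; apply: leq_trans le.
have exd : exists d, `[< exists n, \dim (U n) = d >].
  by exists (\dim (U 0%N)); apply/asboolP; exists 0%N.
case: (ex_minnP exd) => d /asboolP[N dN] dmin.
have stab n : (U N <= U n)%VS.
  case: (leqP n N) => [/mono //|/ltnW/mono le].
  suff -> : U n = U N by [].
  by apply/eqP; rewrite eqEdim le dN; apply: dmin; apply/asboolP; exists n.
exists N => z mz; case: phiP => _ _ _ ker; apply/ker => n.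
(* By stability [z] has the same image as some [t] in the [n]-th power. So [z - t] is in the closed
   ideal, and it agrees with [z] on paths shorter than [n]. *)
have /UP[t [mt et]] : phi z \in U n.
  by apply: (subvP (stab n)); apply/UP; exists z.
have /ker/(_ n)[w [gw ew]] : phi (z - t) = 0.
  by rewrite phiD -scaleN1r phiZ et scaleN1r subrr.
by exists w; split=> // p lp; rewrite -ew // path_algebra_subE mt // subr0.
Qed.

Lemma arrow_imageMl x y : in_arrow_image 1 x -> in_arrow_image 1 (y * x).
Proof.
move=> [z [mz <-]]; have [t <-] := phi_surj y; exists (t * z); split=> //.
exact: (@arrow_idealM _ _ 0 1).
Qed.

Lemma arrow_imageMr x y : in_arrow_image 1 x -> in_arrow_image 1 (x * y).
Proof.
move=> [z [mz <-]]; have [t <-] := phi_surj y; exists (z * t); split=> //.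
exact: (@arrow_idealM _ _ 1 0).
Qed.

Lemma arrow_image_nilpotent x : in_arrow_image 1 x -> exists n, x ^+ n = 0.
Proof.
move=> [z [mz <-]]; have [N hN] := arrow_ideal_vanishes; exists N.
have -> : phi z ^+ N = phi (z ^+ N).
  by elim: N {hN} => [|n IH]; rewrite ?expr0 ?phi1 // !exprS IH phiM.
apply: hN; elim: N => [|n IH]; first exact: arrow_ideal0.
by rewrite exprS; exact: (@arrow_idealM _ _ 1 n).
Qed.

Lemma arrow_image_decomp x : exists c : vertex Q -> K,
  in_arrow_image 1 (x - \sum_v c v *: phi (vertex_idem K v)).
Proof.
have [z <-] := phi_surj x; exists (fun v => z (trivial_path v)).
eexists; split; first exact: (arrow_ideal_decomp z).
rewrite phiD -scaleN1r phiZ scaleN1r phi_sum; congr (_ - _).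
by apply: eq_bigr => v _; rewrite phiZ.
Qed.

(* If S is a simple right ideal and s is in S, then s I is 0 or S for the      *)
(* nilpotent ideal I, and S = s I would give s = s w = s w^n = 0.              *)
Lemma semisimple_arrow_image0 x :
  semisimple_algebra A -> in_arrow_image 1 x -> x = 0.
Proof.
move=> [n [S [Ssimple _ Sfull]]] mx; have [U UP] := arrow_image_space.
have S0 i s : s \in S i -> s * x = 0.
  move=> sS; have [ideal nz simple] := Ssimple i.
  have s_lin : linear (fun y : A => s * y : A).
    by move=> k y z; rewrite mulrDr fd_scaleAr.
  pose f := lin_hom s_lin.
  have fE y : f y = s * y by rewrite /f lin_homE.
  have fideal : right_ideal (f @: U 1%N)%VS.
    move=> a _ /memv_imgP[y /UP yU ->]; apply/memv_imgP; exists (y * a).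
      by apply/UP; exact: arrow_imageMr.
    by rewrite !fE mulrA.
  have fS : (f @: U 1%N <= S i)%VS.
    by apply/subvP => _ /memv_imgP[y _ ->]; rewrite fE; exact: ideal.
  have fx : s * x \in (f @: U 1%N)%VS by rewrite -fE memv_img //; apply/UP.
  case: (simple _ fideal fS) => e; first by apply/eqP; rewrite -memv0 -e.
  have /memv_imgP[w /UP/arrow_image_nilpotent[k wk]] : s \in (f @: U 1%N)%VS by rewrite e.
  rewrite fE => es; suff -> : s = 0 by rewrite mul0r.
  rewrite -[RHS](mulr0 s) -wk; elim: k {wk} => [|k IH]; first by rewrite mulr1.
  by rewrite exprS mulrA -es.
rewrite -[x]mul1r; have : (1 : A) \in (\sum_i S i)%VS by rewrite Sfull memvf.
move=> /memv_sumP[v vS ->]; rewrite mulr_suml big1 // => i _; exact: S0 (vS i isT).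
Qed.

Lemma semisimple_rigid : semisimple_algebra A -> rigid phi.
Proof.
move=> ss b; have [c /(semisimple_arrow_image0 ss) e] := arrow_image_decomp b.
exists c, 0%N, (fun=> 0), (fun=> 0); rewrite big_ord0 addr0.
by apply/eqP; rewrite -subr_eq0 e.
Qed.

Let e v : A := phi (vertex_idem K v).

Let eM v w : e v * e w = (v == w)%:R *: e v.
Proof. by rewrite /e -phiM vertex_idemM phiZ. Qed.

(** By orthogonality [e v * x] is a multiple of [e v], so each nonzero [e v] spans a
    one-dimensional, hence simple, right ideal, and the sum of these is direct. Vertices with
    [e v = 0] are left out because the zero ideal is not simple. *)
Lemma vertex_span_semisimple :
  (forall x : A, exists c : vertex Q -> K, x = \sum_v c v *: e v) ->
  semisimple_algebra A.
Proof.
move=> span; pose n := #|[pred v | e v != 0]|.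
pose s (i : 'I_n) : vertex Q := enum_val i.
have snz i : e (s i) != 0 by have := enum_valP i; rewrite inE.
have e_mul v (x : A) : exists k, e v * x = k *: e v.
  have [c ->] := span x; exists (c v); rewrite mulr_sumr (bigD1 v) //=.
  rewrite -fd_scaleAr eM eqxx scale1r big1 ?addr0 // => w wv.
  by rewrite -fd_scaleAr eM eq_sym (negPf wv) scale0r scaler0.
exists n, (fun i => <[e (s i)]>%VS); split=> [i||].
- split.
  + move=> a x /vlineP[k ->]; have [l el] := e_mul (s i) a.
    by rewrite -fd_scaleAl el !memvZ // memv_line.
  + by move=> h; move: (snz i); rewrite -memv0 -h memv_line.
  + move=> J _ JS; case: (eqVneq J 0%VS) => [|Jnz]; first by left.
    right; apply/eqP; rewrite eqEdim JS dim_vline snz lt0n dimv_eq0 //.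
- apply/directv_sum_independent => u uS su i _.
  have [k ek] := vlineP _ _ (uS i isT); rewrite ek.
  have := congr1 (fun x : A => e (s i) * x) su; rewrite mulr0 mulr_sumr (bigD1 i) //=.
  rewrite ek -fd_scaleAr eM eqxx scale1r big1 ?addr0 // => j ji.
  have [l ->] := vlineP _ _ (uS j isT); rewrite -fd_scaleAr eM.
  case: eqP => [/enum_val_inj eij|_]; last by rewrite scale0r scaler0.
  by rewrite eij eqxx in ji.
- apply/eqP; rewrite eqEsubv subvf /=; apply/subvP => x _.
  have [c ->] := span x; apply: memv_suml => v _.
  case: (eqVneq (e v) 0) => [->|nz]; first by rewrite scaler0 mem0v.
  have vin : v \in [pred v | e v != 0] by [].
  apply: (subvP (sumv_sup (enum_rank_in vin v) isT (subvv _))).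
  by rewrite /s enum_rankK_in // memvZ // memv_line.
Qed.

(* Modulo the nilpotent ideal I generated by the arrows, A is spanned by       *)
(* orthogonal idempotents, hence commutative, so rigidity puts I in [A, A].     *)
(* A symmetrizing form then vanishes on the ideal I, whence I = 0.             *)
Lemma rigid_semisimple : symmetric_algebra A -> rigid phi -> semisimple_algebra A.
Proof.
move=> /symmetric_form[lam [lamC lam_nd _]] rig.
have [U UP] := arrow_image_space.
have commU x y : x * y - y * x \in U 1%N.
  have [c /UP cx] := arrow_image_decomp x; have [d /UP dy] := arrow_image_decomp y.
  set x' := \sum_v _ in cx; set y' := \sum_v _ in dy.
  have xy' : x' * y' = y' * x'.
    rewrite /x' /y' !mulr_suml; under eq_bigr do rewrite mulr_sumr.
    rewrite exchange_big /=; apply: eq_bigr => v _; rewrite mulr_sumr.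
    apply: eq_bigr => w _; rewrite -!fd_scaleAl -!fd_scaleAr.
    rewrite -/(e v) -/(e w) !eM eq_sym; case: eqP => [->|_].
      by rewrite !scalerA [c w * _]mulrC.
    by rewrite !scale0r !scaler0.
  (* Since [x'] and [y'] commute, the commutator is a combination of products that each have a
     factor [x - x'] or [y - y'] in I. *)
  have -> : x * y - y * x = (x - x') * y + x' * (y - y') - ((y - y') * x + y' * (x - x')).
    have t (a b a' b' : A) : (a - a') * b + a' * (b - b') = a * b - a' * b'.
      by rewrite mulrBl mulrBr addrA subrK.
    by rewrite !t xy' opprB addrA subrK.
  by rewrite rpredB // rpredD //; apply/UP;
    (apply: arrow_imageMl + apply: arrow_imageMr); apply/UP.

have lam0 x : x \in U 1%N -> lam x = 0.
  move=> xU; have [c [n [y [z ex]]]] := rig x.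
  have csU : \sum_v c v *: e v \in U 1%N.
    rewrite (_ : \sum_v _ = x - \sum_i (y i * z i - z i * y i)); last by rewrite ex addrK.
    by rewrite rpredB // rpred_sum.
  (* Multiplication by [e v] isolates one summand inside I. If [c v] is nonzero, the idempotent
     [e v] itself lies in I, so it is nilpotent and therefore 0. *)
  have ce v : c v *: e v = 0.
    have cU : c v *: e v \in U 1%N.
      rewrite (_ : c v *: e v = e v * \sum_v c v *: e v); first by apply/UP/arrow_imageMl/UP.
      rewrite mulr_sumr (bigD1 v) //= -fd_scaleAr eM eqxx scale1r big1 ?addr0 // => w wv.
      by rewrite -fd_scaleAr eM eq_sym (negPf wv) scale0r scaler0.
    case: (eqVneq (c v) 0) => [->|nz]; first by rewrite scale0r.
    have /UP/arrow_image_nilpotent[k] : e v \in U 1%N.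
      by rewrite -[e v](scalerK nz) rpredZ.
    (* The exponent 0 occurs only if 1 = 0, and then every element of A is 0. *)
    suff -> : e v ^+ k = if k is 0 then 1 else e v.
      case: k => [/esym /= e10|k ->]; last by rewrite scaler0.
      by rewrite -[e v]mul1r -e10 mul0r scaler0.
    elim: k => // -[|k] IH; first by rewrite expr1.
    by rewrite exprS IH eM eqxx scale1r.
  rewrite ex big1 // add0r linear_sum big1 // => i _.
  by rewrite linearB /= lamC subrr.
have U0 x : in_arrow_image 1 x -> x = 0.
  by move=> mx; apply: lam_nd => y; apply: lam0; apply/UP; exact: arrow_imageMr.
apply: vertex_span_semisimple => x; have [c /U0 h] := arrow_image_decomp x.
by exists c; apply/eqP; rewrite -subr_eq0 h.
Qed.

End JacobianQuotient.

(** * Syzygies up to stable equality *)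

Section SyzygySequences.
Variables (K : fieldType) (A : fdalg K).
Implicit Types L M N P : fdmod A.

Lemma msurjective_lift M N P (q : modhom M N) (f : modhom P N) :
  projective P -> msurjective q -> exists g : modhom P M, forall x, q (g x) = f x.
Proof.
move=> pP qs; have [g eg] := pP _ _ q f qs.
by exists g => x; rewrite -eg mcompE.
Qed.

Definition minjective M N (f : modhom M N) : Prop := forall x y, f x = f y -> x = y.

Lemma exact_factor L M N P (i : modhom L M) (p : modhom M N) (f : modhom P M) :
  minjective i -> (forall x, p x = 0 -> exists y, i y = x) ->
  (forall x, p (f x) = 0) -> exists g : modhom P L, forall x, i (g x) = f x.
Proof.
move=> inj ex pf0.
pose g x := sval (cid (ex _ (pf0 x))).
have gE x : i (g x) = f x := svalP (cid (ex _ (pf0 x))).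
have g_lin : linear g by move=> k x y; apply: inj; rewrite linearP /= !gE linearP.
have g_act a x : g (act P a x) = act L a (g x).
  by apply: inj; rewrite modhomP !gE modhomP.
by exists (mk_modhom g_lin g_act) => x; rewrite mk_modhomE.
Qed.

Record syzygy_seq M L := SyzygySeq {
  sq_mid : fdmod A;
  sq_in : modhom L sq_mid;
  sq_out : modhom sq_mid M;
  sq_proj : projective sq_mid;
  sq_surj : msurjective sq_out;
  sq_inj : minjective sq_in;
  sq_zero : forall x, sq_out (sq_in x) = 0;
  sq_exact : forall x, sq_out x = 0 -> exists y, sq_in y = x
}.
End SyzygySequences.

Arguments sq_in {K A M L} s.
Arguments sq_out {K A M L} s.
Arguments sq_proj {K A M L} s.
Arguments sq_surj {K A M L} s.
Arguments sq_inj {K A M L} s.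
Arguments sq_zero {K A M L} s x.
Arguments sq_exact {K A M L} s {x}.

Section SyzygyLifts.
Variables (K : fieldType) (A : fdalg K).
Implicit Types L M N P : fdmod A.

Definition sq_lift M L N L' (E : syzygy_seq M L) (E' : syzygy_seq N L')
    (f : modhom M N) (h : modhom L L') : Prop :=
  exists g : modhom (sq_mid E) (sq_mid E'),
    (forall x, sq_out E' (g x) = f (sq_out E x)) /\
    (forall x, sq_in E' (h x) = g (sq_in E x)).

Lemma sq_lift_ex M L N L' (E : syzygy_seq M L) (E' : syzygy_seq N L') f :
  exists h, sq_lift E E' f h.
Proof.
have [g eg] := msurjective_lift (mcomp f (sq_out E)) (sq_proj E) (sq_surj E').
have [x|h eh] := exact_factor (sq_inj E') (@sq_exact _ _ _ _ E') (f := mcomp g (sq_in E)).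
  by rewrite mcompE eg mcompE sq_zero linear0.
by exists h, g; split=> x; rewrite ?eg ?eh mcompE.
Qed.

(** Write [f - f' = v u] through a projective and lift [v] to [w] along [sq_out E']. Then
    [g - g' - w u (sq_out E)] lands in the kernel [L'], and its last term dies on [L]; hence
    [h - h'] factors through the projective [sq_mid E]. *)
Lemma sq_lift_stable M L N L' (E : syzygy_seq M L) (E' : syzygy_seq N L') f f' h h' :
  stable_eq f f' -> sq_lift E E' f h -> sq_lift E E' f' h' -> stable_eq h h'.
Proof.
move=> /stable_eqP [Q [u [v [pQ e]]]] [g [eg eh]] [g' [eg' eh']].
have [w ew] := msurjective_lift v pQ (sq_surj E').
pose t := msub (msub g g') (mcomp w (mcomp u (sq_out E))).
have [x|s es] := exact_factor (sq_inj E') (@sq_exact _ _ _ _ E') (f := t).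
  rewrite /t !(msubE, mcompE) !modhomB eg eg' ew -(mcompE v) -e msubE.
  by rewrite subrr.
apply/stable_eqP; exists (sq_mid E), (sq_in E), s; split; first exact: sq_proj.
apply: modhom_eq => x; apply: (sq_inj E'); rewrite msubE modhomB eh eh' mcompE es.
by rewrite /t !(msubE, mcompE) sq_zero (linear0 u) (linear0 w) subr0.
Qed.

Lemma sq_lift_id M L (E : syzygy_seq M L) : sq_lift E E (mid M) (mid L).
Proof. by exists (mid _); split=> x; rewrite !midE. Qed.

Lemma sq_lift_comp M L N L' P L'' (E : syzygy_seq M L) (E' : syzygy_seq N L')
    (E'' : syzygy_seq P L'') f h f' h' :
  sq_lift E E' f h -> sq_lift E' E'' f' h' ->
  sq_lift E E'' (mcomp f' f) (mcomp h' h).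
Proof.
move=> [g [e1 e2]] [g' [e3 e4]]; exists (mcomp g' g).
by split=> x; rewrite !mcompE ?e3 ?e1 ?e4 ?e2.
Qed.

Record resolution4 M L := Resolution4 {
  r4_1 : fdmod A; r4_2 : fdmod A; r4_3 : fdmod A;
  r4_seq1 : syzygy_seq M r4_1;
  r4_seq2 : syzygy_seq r4_1 r4_2;
  r4_seq3 : syzygy_seq r4_2 r4_3;
  r4_seq4 : syzygy_seq r4_3 L
}.

Definition r4_lift M L N L' (R : resolution4 M L) (R' : resolution4 N L')
    (f : modhom M N) (h : modhom L L') : Prop :=
  exists f1 f2 f3,
    [/\ sq_lift (r4_seq1 R) (r4_seq1 R') f f1, sq_lift (r4_seq2 R) (r4_seq2 R') f1 f2,
        sq_lift (r4_seq3 R) (r4_seq3 R') f2 f3 & sq_lift (r4_seq4 R) (r4_seq4 R') f3 h].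

Lemma r4_lift_ex M L N L' (R : resolution4 M L) (R' : resolution4 N L') f :
  exists h, r4_lift R R' f h.
Proof.
have [f1 h1] := sq_lift_ex (r4_seq1 R) (r4_seq1 R') f.
have [f2 h2] := sq_lift_ex (r4_seq2 R) (r4_seq2 R') f1.
have [f3 h3] := sq_lift_ex (r4_seq3 R) (r4_seq3 R') f2.
have [h h4] := sq_lift_ex (r4_seq4 R) (r4_seq4 R') f3.
by exists h, f1, f2, f3.
Qed.

Lemma r4_lift_stable M L N L' (R : resolution4 M L) (R' : resolution4 N L') f f' h h' :
  stable_eq f f' -> r4_lift R R' f h -> r4_lift R R' f' h' -> stable_eq h h'.
Proof.
move=> e [f1 [f2 [f3 [a1 a2 a3 a4]]]] [g1 [g2 [g3 [b1 b2 b3 b4]]]].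
have e1 := sq_lift_stable e a1 b1; have e2 := sq_lift_stable e1 a2 b2.
have e3 := sq_lift_stable e2 a3 b3; exact: sq_lift_stable e3 a4 b4.
Qed.

Lemma r4_lift_id M L (R : resolution4 M L) : r4_lift R R (mid M) (mid L).
Proof. by exists (mid _), (mid _), (mid _); split; exact: sq_lift_id. Qed.

Lemma r4_lift_comp M L N L' P L'' (R : resolution4 M L) (R' : resolution4 N L')
    (R'' : resolution4 P L'') f h f' h' :
  r4_lift R R' f h -> r4_lift R' R'' f' h' ->
  r4_lift R R'' (mcomp f' f) (mcomp h' h).
Proof.
move=> [f1 [f2 [f3 [a1 a2 a3 a4]]]] [g1 [g2 [g3 [b1 b2 b3 b4]]]].
exists (mcomp g1 f1), (mcomp g2 f2), (mcomp g3 f3).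
by split; apply: sq_lift_comp; eassumption.
Qed.

Variable S : presentations A.

Definition syzygy_sq M : syzygy_seq M (syzygy S M).
Proof.
apply: (@SyzygySeq K A M (syzygy S M) (pres_obj S M) (ker_incl _) (pres_map S M)).
- exact: pres_projective.
- exact: pres_surjective.
- exact: ker_incl_inj.
- exact: ker_inclP.
- move=> x px; have xk : x \in lker (pres_map S M) by rewrite memv_ker px.
  by exists (vsproj (lker (pres_map S M)) x); rewrite ker_inclE vsprojK.
Defined.

Lemma syzygy_sq_lift M N (f : modhom M N) h :
  sq_lift (syzygy_sq M) (syzygy_sq N) f h ->
  syzygy_map S (stable_class f) = stable_class h.
Proof.
move=> [g [eg eh]]; apply: syzygy_mapE; exists g.
by split; apply: modhom_eq => x; rewrite !mcompE.
Qed.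

Definition syzygy_r4 M :
    resolution4 M (syzygy S (syzygy S (syzygy S (syzygy S M)))) :=
  Resolution4 (syzygy_sq M) (syzygy_sq _) (syzygy_sq _) (syzygy_sq _).

Lemma syzygy_r4_lift M N (f : modhom M N) h :
  r4_lift (syzygy_r4 M) (syzygy_r4 N) f h ->
  fmap (functor_iter 4 (syzygy_functor S))
    (stable_class f : @hom (stable_category A) M N) = stable_class h.
Proof.
move=> [f1 [f2 [f3 [h1 h2 h3 h4]]]].
by rewrite /= (syzygy_sq_lift h1) (syzygy_sq_lift h2) (syzygy_sq_lift h3) (syzygy_sq_lift h4).
Qed.

(* The comparison Omega^4 M -> M between the two resolutions of M is natural   *)
(* because lifts are unique in the stable category.                            *)
Lemma syzygy_periodic4 (R : forall M, resolution4 M M) :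
  (forall M N (f : modhom M N), r4_lift (R M) (R N) f f) ->
  functor_iso (functor_iter 4 (syzygy_functor S)) (functor_id (stable_category A)).
Proof.
move=> RP.
pose th M := sval (cid (r4_lift_ex (syzygy_r4 M) (R M) (mid M))).
have thP M : r4_lift (syzygy_r4 M) (R M) (mid M) (th M) :=
  svalP (cid (r4_lift_ex (syzygy_r4 M) (R M) (mid M))).
exists (fun M => stable_class (th M)); split=> [M|M N f].
  have [k kP] := r4_lift_ex (R M) (syzygy_r4 M) (mid M).
  exists (stable_class k); split; rewrite /= stable_compE; apply/stable_classP.
    apply: r4_lift_stable (stable_eq_refl _) (r4_lift_comp (thP M) kP) _.
    by rewrite mcomp1m; exact: r4_lift_id.
  apply: r4_lift_stable (stable_eq_refl _) (r4_lift_comp kP (thP M)) _.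
  by rewrite mcomp1m; exact: r4_lift_id.
rewrite -[f]stable_repK; move: (stable_rep f) => {}f.
have [h hP] := r4_lift_ex (syzygy_r4 M) (syzygy_r4 N) f.
rewrite (syzygy_r4_lift hP) /= !stable_compE; apply/stable_classP.
apply: r4_lift_stable (r4_lift_comp hP (thP N)) (r4_lift_comp (thP M) (RP _ _ f)).
by rewrite mcomp1m mcompm1 stable_eq_refl.
Qed.

Lemma isomorphic_trans (D : category) (X Y Z : D) :
  isomorphic X Y -> isomorphic Y Z -> isomorphic X Z.
Proof.
move=> [f [g [gf fg]]] [h [k [kh hk]]]; exists (comp h f), (comp g k); split.
  by rewrite compA -(compA g) kh compm1.
by rewrite compA -(compA h) fg compm1.
Qed.

Lemma isomorphic_sym (D : category) (X Y : D) : isomorphic X Y -> isomorphic Y X.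
Proof. by move=> [f [g [gf fg]]]; exists g, f. Qed.

Lemma functor_isomorphic (D E : category) (F : functor D E) (X Y : D) :
  isomorphic X Y -> isomorphic (F X) (F Y).
Proof.
move=> [f [g [gf fg]]]; exists (fmap F f), (fmap F g).
by rewrite -!fmapM gf fg !fmap1.
Qed.

Lemma periodic4_period :
  functor_iso (functor_iter 4 (syzygy_functor S)) (functor_id (stable_category A)) ->
  forall M, exists r, has_syzygy_period S M r /\ (r %| 4)%N.
Proof.
move=> [eta [eta_iso _]] M.
pose Om n : stable_category A := functor_iter n (syzygy_functor S) M.
pose b n := `[< (0 < n)%N /\ isomorphic (Om n) (M : stable_category A) >].
have iso4 : isomorphic (Om 4%N) (M : stable_category A) by exists (eta M); exact: eta_iso.
have exb : exists n, b n by exists 4%N; apply/asboolP; split.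
case: (ex_minnP exb) => r /asboolP[r0 rM] rmin.
have rmin' n : (0 < n)%N -> isomorphic (Om n) (M : stable_category A) -> (r <= n)%N.
  by move=> n0 nM; apply: rmin; apply/asboolP.
exists r; split; first by split.
(* Minimality leaves r at most 4. The value 3 is excluded: Omega^3 M = M would give Omega M =
   Omega^4 M = M, that is r = 1. *)
have := rmin' 4%N isT iso4; case: (eqVneq r 3) => [r3 _|].
  suff : (r <= 1)%N by rewrite r3.
  apply: rmin' => //; apply: isomorphic_trans iso4.
  apply: isomorphic_sym; rewrite r3 in rM.
  exact: (functor_isomorphic (syzygy_functor S) rM).
by case: r r0 {rM rmin rmin'} => [|[|[|[|[|r]]]]].
Qed.

End SyzygyLifts.

(** * Isomorphisms of modules and transport of syzygy sequences *)

Section ModuleBijections.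
Variables (K : fieldType) (A : fdalg K).
Implicit Types L M N P : fdmod A.

(** The map is [q] composed with a set-theoretic section of [p]. Equality of the kernels makes it
    independent of the section, and hence a module homomorphism. *)
Lemma cokernel_unique M N P (p : modhom P M) (q : modhom P N) :
  msurjective p -> msurjective q -> (forall x, p x = 0 <-> q x = 0) ->
  exists f : modhom M N, [/\ minjective f, msurjective f & forall x, f (p x) = q x].
Proof.
move=> ps qs pq.
pose s y := sval (cid (ps y)); have sE y : p (s y) = y := svalP (cid (ps y)).
have wd x y : p x = p y <-> q x = q y.
  have eq0 (Q : fdmod A) (f : modhom P Q) : f x = f y <-> f (x - y) = 0.
    rewrite modhomB; split=> [->|/eqP]; first by rewrite subrr.
    by rewrite subr_eq0 => /eqP.
  by rewrite !eq0.
have qsp x : q (s (p x)) = q x by apply/wd; rewrite sE.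
have f_lin : linear (fun y => q (s y)).
  move=> k x y; rewrite -linearP; apply/wd; rewrite linearP /= !sE //.
have f_act a x : q (s (act M a x)) = act N a (q (s x)).
  by rewrite -modhomP; apply/wd; rewrite modhomP !sE.
exists (mk_modhom f_lin f_act); split=> [x y|y|x]; rewrite ?mk_modhomE ?qsp //.
  by move/wd; rewrite !sE.
by have [x <-] := qs y; exists (p x); rewrite mk_modhomE qsp.
Qed.

Lemma mid_inj M : minjective (mid M).
Proof. by move=> x y; rewrite !midE. Qed.
Lemma mid_surj M : msurjective (mid M).
Proof. by move=> y; exists y; rewrite midE. Qed.

Lemma modhom_inverse M N (f : modhom M N) : minjective f -> msurjective f ->
  exists g : modhom N M, (forall x, g (f x) = x) /\ (forall y, f (g y) = y).
Proof.
move=> fi fs; have [x|g [_ _ gf]] := cokernel_unique fs (@mid_surj M).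
  rewrite midE; split=> [fx|->]; last exact: linear0.
  by apply: fi; rewrite fx linear0.
have gE x : g (f x) = x by rewrite gf midE.
by exists g; split=> // y; have [x <-] := fs y; rewrite gE.
Qed.

Section Conjugate.
Variables (M L M' L' : fdmod A) (E : syzygy_seq M L).
Variables (a : modhom M M') (b : modhom L' L).
Hypotheses (ai : minjective a) (asj : msurjective a).
Hypotheses (bi : minjective b) (bsj : msurjective b).

(** Relabels both ends along isomorphisms, so that a resolution can be made to begin and end with
    the same module. *)
Definition sq_conj : syzygy_seq M' L'.
Proof.
apply: (@SyzygySeq _ _ M' L' (sq_mid E) (mcomp (sq_in E) b) (mcomp a (sq_out E))).
- exact: sq_proj.
- move=> y; have [z <-] := asj y; have [x <-] := sq_surj E z.
  by exists x; rewrite mcompE.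
- by move=> x y; rewrite !mcompE => /(sq_inj E)/bi.
- by move=> x; rewrite !mcompE sq_zero linear0.
- move=> x; rewrite mcompE -[RHS](linear0 a) => /ai/(sq_exact E)[y <-].
  by have [z <-] := bsj y; exists z; rewrite mcompE.
Defined.
End Conjugate.

Lemma sq_conj_lift M L M' L' N P N' P'
    (E : syzygy_seq M L) (F : syzygy_seq N P)
    (a : modhom M M') (b : modhom L' L) ai asj bi bsj
    (c : modhom N N') (d : modhom P' P) ci csj di dsj f h
    (f' : modhom M' N') (h' : modhom L' P') :
  sq_lift E F f h -> (forall x, c (f x) = f' (a x)) -> (forall x, d (h' x) = h (b x)) ->
  sq_lift (@sq_conj _ _ M' L' E a b ai asj bi bsj)
          (@sq_conj _ _ N' P' F c d ci csj di dsj) f' h'.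
Proof.
move=> [g [e1 e2]] cf dh; exists g; split=> x; rewrite /= !mcompE.
  by rewrite e1 cf.
by rewrite dh e2.
Qed.
End ModuleBijections.

(** * Triangulated categories *)

Section Equivalences.
Variables (D E : category).

Lemma is_equivalence_ess_surj (F : functor D E) :
  is_equivalence F -> forall Y, exists X, isomorphic Y (F X).
Proof.
move=> [G [_ [eps [eps_iso _]]]] Y; exists (G Y).
by have [g [e1 e2]] := eps_iso Y; exists g, (eps Y).
Qed.

Lemma is_equivalence_faithful (F : functor D E) : is_equivalence F ->
  forall X Y (f g : hom X Y), fmap F f = fmap F g -> f = g.
Proof.
move=> [G [[eta [eta_iso etaN]] _]] X Y f g /(congr1 (fmap G)) e.
have [h [_ h2]] := eta_iso X.
rewrite -[f]compm1 -[g]compm1 -h2 !compA; congr (comp _ h).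
by have := etaN _ _ f; have := etaN _ _ g; rewrite /= e => -> ->.
Qed.
End Equivalences.

Lemma is_equivalence_inverse (D E : category) (F : functor D E) :
  is_equivalence F -> exists2 G : functor E D, is_equivalence G &
  functor_iso (functor_comp G F) (functor_id D).
Proof. by move=> [G [h1 h2]]; exists G => //; exists F. Qed.

Lemma is_equivalence_full (D E : category) (F : functor D E) : is_equivalence F ->
  forall X Y (h : hom (F X) (F Y)), exists f, fmap F f = h.
Proof.
move=> /is_equivalence_inverse[G /is_equivalence_faithful Gf [eta [eta_iso etaN]]] X Y h.
have [k [k1 k2]] := eta_iso X; have [l [l1 l2]] := eta_iso Y.
(* Conjugating [G h] by the isomorphism [eta] from [G F] to the identity gives [f] with
   [G (F f) = G h], and [G], an equivalence too, is faithful. *)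
exists (comp (eta Y) (comp (fmap G h) k)); apply: Gf.
set f := comp _ _; have := etaN _ _ f; rewrite /= => ef.
rewrite -[LHS]comp1m -l1 -compA ef /f -!compA k1 compm1 !compA l1.
by rewrite comp1m.
Qed.

(** * Linear categories and add T *)

Section LinearComp.
Variables (K : fieldType) (C : linear_category K).
Implicit Types X Y Z W T : C.

Lemma lcomp0m X Y Z (f : lhom X Y) : (0 : lhom Y Z) \oc f = 0.
Proof.
by have := lcomp_linearl f (-1) 0 (0 : lhom Y Z); rewrite scaler0 addr0 scaleN1r addNr.
Qed.
Lemma lcompm0 X Y Z (g : lhom Y Z) : g \oc (0 : lhom X Y) = 0.
Proof.
by have := lcomp_linearr g (-1) 0 (0 : lhom X Y); rewrite scaler0 addr0 scaleN1r addNr.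
Qed.
Lemma lcompDl X Y Z (f : lhom X Y) (g h : lhom Y Z) :
  (g + h) \oc f = (g \oc f) + (h \oc f).
Proof. by have := lcomp_linearl f 1 g h; rewrite !scale1r. Qed.
Lemma lcompDr X Y Z (g : lhom Y Z) (f h : lhom X Y) :
  g \oc (f + h) = (g \oc f) + (g \oc h).
Proof. by have := lcomp_linearr g 1 f h; rewrite !scale1r. Qed.
Lemma lcompZl X Y Z (f : lhom X Y) (k : K) (g : lhom Y Z) :
  (k *: g) \oc f = k *: (g \oc f).
Proof. by have := lcomp_linearl f k g 0; rewrite !addr0 lcomp0m addr0. Qed.
Lemma lcompZr X Y Z (g : lhom Y Z) (k : K) (f : lhom X Y) :
  g \oc (k *: f) = k *: (g \oc f).
Proof. by have := lcomp_linearr g k f 0; rewrite !addr0 lcompm0 addr0. Qed.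
Lemma lcompNl X Y Z (f : lhom X Y) (g : lhom Y Z) : (- g) \oc f = - (g \oc f).
Proof. by rewrite -[- g]scaleN1r lcompZl scaleN1r. Qed.
Lemma lcompNr X Y Z (g : lhom Y Z) (f : lhom X Y) : g \oc (- f) = - (g \oc f).
Proof. by rewrite -[- f]scaleN1r lcompZr scaleN1r. Qed.
Lemma lcompBl X Y Z (f : lhom X Y) (g h : lhom Y Z) :
  (g - h) \oc f = (g \oc f) - (h \oc f).
Proof. by rewrite lcompDl lcompNl. Qed.
Lemma lcompBr X Y Z (g : lhom Y Z) (f h : lhom X Y) :
  g \oc (f - h) = (g \oc f) - (g \oc h).
Proof. by rewrite lcompDr lcompNr. Qed.
Lemma lcomp_suml (I : finType) X Y Z (f : lhom X Y) (g : I -> lhom Y Z) :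
  (\sum_i g i) \oc f = \sum_i (g i \oc f).
Proof.
by apply: (big_morph (fun g => g \oc f)) => [x y|]; rewrite ?lcompDl ?lcomp0m.
Qed.
Lemma lcomp_sumr (I : finType) X Y Z (g : lhom Y Z) (f : I -> lhom X Y) :
  g \oc (\sum_i f i) = \sum_i (g \oc f i).
Proof.
by apply: (big_morph (lcomp g)) => [x y|]; rewrite ?lcompDr ?lcompm0.
Qed.

Lemma zero_objectP Z : is_zero_object Z <-> lidm Z = 0.
Proof.
split=> [[inj [prj [_ _]]]|Z0]; first by rewrite big_ord0 => <-.
by exists (fun=> 0), (fun=> 0); split=> [[]|[]|] //; rewrite big_ord0.
Qed.

Lemma zero_object_ex : is_additive C -> exists Z : C, is_zero_object Z.
Proof.
(* The biproduct of the empty family; an index in ['I_0] is contradictory. *)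
move=> /(_ 'I_0 (fun i => match notF (valP i) return C with end))[Z [inj [prj [_ _ h]]]].
by exists Z; apply/zero_objectP; rewrite -h big_ord0.
Qed.

(** The form in which membership in add T is used: the identity of [W] factors through a power of
    [T], so facts about [T] pass to [W] by summation. *)
Lemma in_add_decomp T W : in_add T W ->
  exists n (q : 'I_n -> lhom T W) (p : 'I_n -> lhom W T), \sum_i (q i \oc p i) = lidm W.
Proof.
move=> [n [S [Y [[i [p [_ _ e]]] [j [r [rj _ _]]]]]]].
exists n, (fun k => r true \oc i k), (fun k => p k \oc j true).
under eq_bigr do rewrite lcompA -(lcompA (r true)).
by rewrite -lcomp_suml -lcomp_sumr e lcompm1; exact: (rj true).
Qed.

Lemma biproduct_in_add n T W : is_additive C ->
  is_biproduct (fun _ : 'I_n => T) W -> in_add T W.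
Proof.
move=> /zero_object_ex[Z /zero_objectP Z0] WT; exists n, W, Z; split=> //.
exists (fun b => if b return lhom (if b then W else Z) W then lidm W else 0),
  (fun b => if b return lhom W (if b then W else Z) then lidm W else 0).
split=> [[]|[] []|] //=; rewrite ?lcomp1m ?lcompm1 ?lcomp0m ?lcompm0 //.
rewrite big_bool -[LHS]/((lidm W \oc lidm W) + ((0 : lhom Z W) \oc (0 : lhom W Z))).
by rewrite lcomp1m lcomp0m addr0.
Qed.

Lemma in_add_self T : is_additive C -> in_add T T.
Proof.
move=> add; apply: (@biproduct_in_add 1) => //.
exists (fun=> lidm T), (fun=> lidm T); split=> [i|i j|]; rewrite ?lcomp1m //.
  by rewrite !ord1.
by rewrite big_ord1.
Qed.

Lemma in_add_hom0 T W Y : in_add T W ->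
  (forall f : lhom T Y, f = 0) -> forall f : lhom W Y, f = 0.
Proof.
move=> /in_add_decomp[n [q [p e]]] h f; rewrite -[f]lcompm1 -e lcomp_sumr big1 // => i _.
by rewrite lcompA (h (f \oc q i)) lcomp0m.
Qed.

Lemma in_add_hom0r T W Y : in_add T W ->
  (forall f : lhom Y T, f = 0) -> forall f : lhom Y W, f = 0.
Proof.
move=> /in_add_decomp[n [q [p e]]] h f; rewrite -[f]lcomp1m -e lcomp_suml big1 // => i _.
by rewrite -lcompA (h (p i \oc f)) lcompm0.
Qed.

(** When [X] lies in add T, this says that [v] is a right add T-approximation of [Y]. *)
Definition generated_by T X Y (v : lhom X Y) : Prop :=
  forall f : lhom T Y, exists f' : lhom T X, v \oc f' = f.

Lemma in_add_lift T W X Y (v : lhom X Y) : in_add T W -> generated_by T v ->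
  generated_by W v.
Proof.
move=> /in_add_decomp[n [q [p e]]] h f.
pose l i := sval (cid (h (f \oc q i))).
have lE i : v \oc l i = f \oc q i := svalP (cid (h (f \oc q i))).
exists (\sum_i (l i \oc p i)); rewrite lcomp_sumr.
under eq_bigr do rewrite lcompA lE -lcompA.
by rewrite -lcomp_sumr e lcompm1.
Qed.

(** [W] is a power of [T] with one copy for each vector of a basis of Hom(T, X), and [v] has that
    basis as components; the coordinates of [f] give its lift. *)
Lemma approximation T X : is_additive C ->
  exists W (v : lhom W X), in_add T W /\ generated_by T v.
Proof.
move=> add; pose b := vbasis {:@lhom K C T X}.
have [W WT] := add 'I_(\dim {:@lhom K C T X}) (fun=> T).
have inW := biproduct_in_add add WT.
have [i [p [pi pj _]]] := WT.
exists W, (\sum_(k < \dim {:@lhom K C T X}) (b`_k \oc p k)); split=> // f.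
exists (\sum_(k < \dim {:@lhom K C T X}) coord b k f *: i k).
rewrite [RHS](coord_vbasis (memvf f)) lcomp_suml.
apply: eq_bigr => k _; rewrite -lcompA lcomp_sumr (bigD1 k) //= lcompZr pi.
rewrite big1 ?addr0 ?lcompZr ?lcompm1 // => j jk.
by rewrite lcompZr pj // scaler0.
Qed.

End LinearComp.

(** * Distinguished triangles *)

Section Triangles.
Variables (K : fieldType) (C : linear_category K) (Sigma : functor C C).
Variables (dist : triangles Sigma) (tri : is_triangulated dist).
Implicit Types X Y Z W T U : C.
Notation S := (fmapl Sigma).

Lemma susp_comp X Y Z (g : lhom Y Z) (f : lhom X Y) : S (g \oc f) = S g \oc S f.
Proof. exact: (@fmapM _ _ Sigma). Qed.
Lemma susp_id X : S (lidm X) = lidm (Sigma X : C).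
Proof. exact: (@fmap1 _ _ Sigma). Qed.
Lemma susp0 X Y : S (0 : lhom X Y) = 0.
Proof. by have := tri_linear tri (-1) 0 (0 : lhom X Y); rewrite scaler0 addr0 scaleN1r addNr. Qed.
Lemma suspZD k X Y (f g : lhom X Y) : S (k *: f + g) = k *: S f + S g.
Proof. exact: (tri_linear tri). Qed.
Lemma suspN X Y (f : lhom X Y) : S (- f) = - S f.
Proof. by rewrite -[- f]addr0 -scaleN1r suspZD susp0 addr0 scaleN1r. Qed.
Lemma suspD X Y (f g : lhom X Y) : S (f + g) = S f + S g.
Proof. by have := suspZD 1 f g; rewrite !scale1r. Qed.
Lemma susp_inj X Y (f g : lhom X Y) : S f = S g -> f = g.
Proof. exact: (is_equivalence_faithful (tri_equiv tri)). Qed.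
Lemma susp_full X Y (h : lhom (Sigma X : C) (Sigma Y : C)) : exists f, S f = h.
Proof. exact: (is_equivalence_full (tri_equiv tri)). Qed.
Lemma susp_ess_surj Y : exists X (f : lhom Y (Sigma X : C)) (g : lhom (Sigma X : C) Y),
  g \oc f = lidm Y /\ f \oc g = lidm (Sigma X : C).
Proof.
by have [X [f [g e]]] := is_equivalence_ess_surj (tri_equiv tri) Y; exists X, f, g.
Qed.

Lemma dist_rotate X Y Z (u : lhom X Y) (v : lhom Y Z) (w : lhom Z (Sigma X)) :
  dist u v w -> dist v w (- S u).
Proof. by case: (tri_rotate tri u v w). Qed.

Lemma dist_unrotate X Y Z (u : lhom X Y) (v : lhom Y Z) (w : lhom Z (Sigma X)) :
  dist v w (- S u) -> dist u v w.
Proof. by case: (tri_rotate tri u v w). Qed.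

(** Three rotations suspend a triangle and negate its maps; after six the signs cancel. *)
Lemma dist_susp2 X Y Z (u : lhom X Y) (v : lhom Y Z) (w : lhom Z (Sigma X)) :
  dist u v w -> dist (S (S u)) (S (S v)) (S (S w)).
Proof.
move=> /dist_rotate/dist_rotate/dist_rotate/dist_rotate/dist_rotate/dist_rotate.
by rewrite !suspN !opprK.
Qed.

Lemma dist_comp0 X Y Z (u : lhom X Y) (v : lhom Y Z) (w : lhom Z (Sigma X)) :
  dist u v w -> v \oc u = 0.
Proof.
move=> d; have [O O0] := zero_object_ex (tri_additive tri).
have := tri_complete tri (f := lidm X) (g := u) (tri_id tri X O0) d.
by rewrite lcompm1 => /(_ erefl)[h [<- _]]; rewrite lcompm0.
Qed.

(** The pair (0, [e]) extends to a morphism into the triangle 0 -> U = U -> 0, whose third component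
    is the factor. *)
Lemma dist_factor X Y Z U (u : lhom X Y) (v : lhom Y Z) (w : lhom Z (Sigma X))
  (e : lhom Y U) : dist u v w -> e \oc u = 0 -> exists h, h \oc v = e.
Proof.
move=> d eu; have [O O0] := zero_object_ex (tri_additive tri).
have SO0 : is_zero_object (Sigma O : C).
  by apply/zero_objectP; rewrite -susp_id (iffLR (zero_objectP _) O0) susp0.
have d' : dist (0 : lhom O U) (lidm U) (0 : lhom U (Sigma O)).
  by apply: dist_unrotate; rewrite susp0 oppr0; exact: tri_id.
have [|h [h1 _]] := tri_complete tri (f := 0 : lhom X O) (g := e) d d'.
  by rewrite eu lcomp0m.
by exists h; rewrite h1 lcomp1m.
Qed.

(** A morphism from the rotated trivial triangle U -> 0 -> Sigma U to the rotated given one has as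
    third component the suspension of the lift. *)
Lemma dist_lift X Y Z U (u : lhom X Y) (v : lhom Y Z) (w : lhom Z (Sigma X))
  (f : lhom U Y) : dist u v w -> v \oc f = 0 -> exists f', u \oc f' = f.
Proof.
move=> d vf; have [O O0] := zero_object_ex (tri_additive tri).
have [|h [_]] := tri_complete tri (f := f) (g := 0 : lhom O Z)
  (dist_rotate (tri_id tri U O0)) (dist_rotate d).
  by rewrite vf lcomp0m.
have [f' <-] := susp_full h; rewrite susp_id lcompNr lcompm1 lcompNl => /oppr_inj.
by rewrite -susp_comp => /susp_inj e; exists f'.
Qed.

(* An endomorphism e of a triangle which is the identity on the first two      *)
(* terms has (e - 1)^2 = 0 on the third.                                       *)
Lemma dist_endo_iso X Y Z (u : lhom X Y) (v : lhom Y Z) (w : lhom Z (Sigma X))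
  (e : lhom Z Z) : dist u v w -> e \oc v = v -> w \oc e = w ->
  exists e' : lhom Z Z, e' \oc e = lidm Z /\ e \oc e' = lidm Z.
Proof.
move=> d ev we; set n := e - lidm Z.
have [a aw] : exists a, a \oc w = n.
  by apply: (dist_factor (dist_rotate d)); rewrite lcompBl ev lcomp1m subrr.
have n2 : n \oc n = 0.
  by rewrite -{1}aw -lcompA /n lcompBr we lcompm1 subrr lcompm0.
have eE : e = lidm Z + n by rewrite addrC subrK.
exists (lidm Z - n); rewrite eE; split; clearbody n.
  by rewrite lcompBl !lcompDr !lcomp1m lcompm1 n2 addr0 addrK.
by rewrite lcompDl !lcompBr !lcomp1m lcompm1 n2 subr0 subrK.
Qed.

(** Complete the square in both directions to [h] and [h']. Both composites are invertible by
    [dist_endo_iso], so [h] has a left and a right inverse, and these agree. *)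
Lemma dist_iso X Y Z X' Y' Z'
    (u : lhom X Y) (v : lhom Y Z) (w : lhom Z (Sigma X))
    (u' : lhom X' Y') (v' : lhom Y' Z') (w' : lhom Z' (Sigma X'))
    (f : lhom X X') (f' : lhom X' X) (g : lhom Y Y') (g' : lhom Y' Y) :
  dist u v w -> dist u' v' w' ->
  f' \oc f = lidm X -> f \oc f' = lidm X' -> g' \oc g = lidm Y -> g \oc g' = lidm Y' ->
  g \oc u = u' \oc f -> @isomorphic C Z Z'.
Proof.
move=> d d' ff' f'f gg' g'g sq.
have sq' : g' \oc u' = u \oc f'.
  by rewrite -[u']lcompm1 -f'f (lcompA u') -sq !lcompA gg' lcomp1m.
have [h [hv hw]] := tri_complete tri d d' sq.
have [h' [hv' hw']] := tri_complete tri d' d sq'.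
have [||k [k1 k2]] := dist_endo_iso (e := h' \oc h) d.
- by rewrite -lcompA hv lcompA hv' -lcompA gg' lcompm1.
- by rewrite lcompA -hw' -lcompA -hw lcompA -susp_comp ff' susp_id lcomp1m.
have [||l [l1 l2]] := dist_endo_iso (e := h \oc h') d'.
- by rewrite -lcompA hv' lcompA hv -lcompA g'g lcompm1.
- by rewrite lcompA -hw -lcompA -hw' lcompA -susp_comp f'f susp_id lcomp1m.
have e : k \oc h' = h' \oc l.
  by rewrite -[k \oc h']lcompm1 -l2 -!lcompA (lcompA h' h) lcompA k1 lcomp1m.
exists h, (k \oc h'); split; first by rewrite -[LHS]lcompA.
by rewrite e -[RHS]l2; exact: lcompA.
Qed.

End Triangles.

(** * The square of the suspension on a cluster-tilting object *)

Section PerfectPairing.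
Variables (K : fieldType) (V W : vectType K) (phi : V -> 'Hom(W, K^o)).
Hypotheses (phi_linear : linear phi) (phi_bij : bijective phi).

(** The [h i] are the preimages of the coordinate functionals of [W], that is, the dual basis in
    [V]. It shows that the pairing is perfect in the other variable as well. *)
Lemma pairing_dual_basis : exists h : 'I_(\dim {:W}) -> V,
  (forall i t, phi (h i) t = coord (vbasis {:W}) i t) /\
  (forall v, v = \sum_(i < \dim {:W}) phi v (vbasis {:W})`_i *: h i).
Proof.
have [psi phiK psiK] := phi_bij.
have c_lin (i : 'I_(\dim {:W})) : linear (coord (vbasis {:W}) i : W -> K^o).
  by move=> k x y; rewrite linearP.
pose h i := psi (lin_hom (c_lin i)).
have hE i t : phi (h i) t = coord (vbasis {:W}) i t by rewrite psiK lin_homE.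
have phi0 : phi 0 = 0.
  by have := phi_linear (-1) 0 0; rewrite scaler0 addr0 scaleN1r addNr.
have phi_sum (F : 'I_(\dim {:W}) -> V) : phi (\sum_i F i) = \sum_i phi (F i).
  by apply: (big_morph phi) => // x y; have := phi_linear 1 x y; rewrite !scale1r.
have phiZ k x : phi (k *: x) = k *: phi x.
  by have := phi_linear k x 0; rewrite phi0 !addr0.
exists h; split=> // v; apply: (can_inj phiK); apply/lfunP => t.
rewrite phi_sum sum_lfunE {1}(coord_vbasis (memvf t)) linear_sum.
by apply: eq_bigr => i _; rewrite linearZ phiZ lfunE /= hE; exact: mulrC.
Qed.

Lemma pairing_represent (l : 'Hom(V, K^o)) : exists t, forall v, phi v t = l v.
Proof.
have [h [hE vE]] := pairing_dual_basis.
exists (\sum_(i < \dim {:W}) (l (h i) : K) *: (vbasis {:W})`_i) => v.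
rewrite linear_sum [in RHS](vE v) linear_sum; apply: eq_bigr => i _.
by rewrite !linearZ /=; exact: mulrC.
Qed.

Lemma pairing_nondegenerate t : (forall v, phi v t = 0) -> t = 0.
Proof.
have [h [hE _]] := pairing_dual_basis => h0.
by rewrite (coord_vbasis (memvf t)) big1 // => i _; rewrite -hE h0 scale0r.
Qed.
End PerfectPairing.

(** * From the symmetrizing form to the double suspension *)

Section ClusterTilting.
Variables (K : fieldType) (A : fdalg K) (C : linear_category K).
Variables (Sigma : functor C C) (dist : triangles Sigma) (T : C).
Hypotheses (A_symmetric : symmetric_algebra A) (tri : is_triangulated dist).
Hypotheses (CY : has_2CY_duality Sigma) (T_tilting : cluster_tilting Sigma T).
Hypothesis A_end : algebra_iso A (endalg T).
Implicit Types X Y Z W U : C.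
Notation S := (fmapl Sigma).
Notation S2 f := (S (S f)).

Let add : is_additive C := tri_additive tri.

Lemma tilting_rigid (f : lhom T (Sigma T)) : f = 0.
Proof. by apply: (iffLR (T_tilting T)); exact: in_add_self. Qed.

Lemma end_symmetric_form : exists lam : 'Hom(@lhom K C T T, K^o),
  [/\ forall f g : lhom T T, lam (f \oc g) = lam (g \oc f),
      forall f : lhom T T, (forall g, lam (f \oc g) = 0) -> f = 0 &
      forall l : 'Hom(@lhom K C T T, K^o),
        exists f : lhom T T, forall g, l g = lam (f \oc g)].
Proof.
have [lam [lamC lam_nd lam_rep]] := symmetric_form A_symmetric.
have [f [f_lin [f1 fM] [g fK gK]]] := A_end.
have g_lin : linear g.
  by move=> k x y; apply: (can_inj fK); rewrite f_lin !gK.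
have gM (x y : lhom T T) : g (x \oc y) = g x * g y.
  by apply: (can_inj fK); rewrite fM !gK.
have lg_lin : linear (fun x : @lhom K C T T => lam (g x) : K^o).
  by move=> k x y; rewrite g_lin linearP.
exists (lin_hom lg_lin); split=> [x y|x x0|l].
- by rewrite !lin_homE !gM.
- rewrite -[x]gK; have -> : g x = 0.
    by apply: lam_nd => y; have := x0 (f y); rewrite lin_homE gM fK.
  by have := f_lin (-1) 0 0; rewrite scaler0 addr0 scaleN1r addNr.
have lf_lin : linear (fun x : A => l (f x) : K^o).
  by move=> k x y; rewrite f_lin linearP.
have [a ea] := lam_rep (lin_hom lf_lin); exists (f a) => y.
by rewrite lin_homE gM fK -ea lin_homE gK.
Qed.

(* Under the duality between Hom(T, T) and Hom(T, Sigma^2 T), g is dual to     *)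
(* the symmetrizing form; that the form is a trace makes g natural.            *)
Lemma double_susp_unit : exists g : lhom T (Sigma (Sigma T) : C),
  [/\ forall a : lhom T T, g \oc a = S2 a \oc g,
      forall a : lhom T T, g \oc a = 0 -> a = 0 &
      forall t : lhom T (Sigma (Sigma T) : C), exists a : lhom T T, g \oc a = t].
Proof.
have [lam [lamC lam_nd lam_rep]] := end_symmetric_form.
have [phi [phil phib phiN]] := CY.
have [g gE] := pairing_represent (@phil T T) (@phib T T) lam.
(* Naturality of the duality in its two variables: composing [g] with [a] on either side amounts to
   multiplying by [a] on one side or the other under [lam]. *)
have e1 (a h : lhom T T) : phi T T h (g \oc a) = lam (a \oc h).
  have := phiN T T T T (lidm T) h a g.
  by rewrite lcompm1 !susp_id lcomp1m => <-.
have e2 (a h : lhom T T) : phi T T h (S2 a \oc g) = lam (h \oc a).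
  have := phiN T T T T a h (lidm T) g.
  by rewrite lcomp1m lcompm1 => <-.
have nd t : (forall h, phi T T h t = 0) -> t = 0.
  exact: (pairing_nondegenerate (@phil T T) (@phib T T)).
exists g; split=> [a|a ga|t].
- apply/eqP; rewrite -subr_eq0; apply/eqP/nd => h.
  by rewrite linearB /= e1 e2 lamC subrr.
- by apply: lam_nd => h; rewrite -e1 ga linear0.
have l_lin : linear (fun h => phi T T h t : K^o).
  by move=> k x y; rewrite phil !lfunE /= !lfunE.
have [a ea] := lam_rep (lin_hom l_lin); exists a.
apply/eqP; rewrite -subr_eq0; apply/eqP/nd => h.
by rewrite linearB /= e1 -ea lin_homE subrr.
Qed.

(* The cone of g has no morphisms from T, so it is Sigma T' with T' in add T;   *)
(* T' -> T composes to 0 with g, hence is 0, the triangle splits, and           *)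
(* T' -> Sigma T = 0 kills the cone.                                            *)
Lemma double_susp_iso : exists (g : lhom T (Sigma (Sigma T) : C))
    (g' : lhom (Sigma (Sigma T) : C) T),
  [/\ forall a : lhom T T, g \oc a = S2 a \oc g, g' \oc g = lidm T &
      g \oc g' = lidm (Sigma (Sigma T) : C)].
Proof.
have [g [gN g_inj g_surj]] := double_susp_unit.
have [Z [v [w d]]] := tri_cone tri g.
have vg := dist_comp0 tri d.
have TZ (q : lhom T Z) : q = 0.
  have [q' eq'] := dist_lift tri (dist_rotate tri d) (tilting_rigid (w \oc q)).
  by have [a ea] := g_surj q'; rewrite -eq' -ea lcompA vg lcomp0m.
have [T' [z [z' [z'z zz']]]] := susp_ess_surj tri Z.
have T'add : in_add T T'.
  by apply/(T_tilting T') => f; rewrite -[f]lcomp1m -zz' -lcompA (TZ (z' \oc f)) lcompm0.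
have [c cE] := susp_full tri (w \oc z').
have gc : g \oc c = 0.
  apply: (susp_inj tri); rewrite susp_comp cE (susp0 tri) lcompA.
  have := dist_comp0 tri (dist_rotate tri (dist_rotate tri d)).
  by rewrite lcompNl => /eqP; rewrite oppr_eq0 => /eqP ->; rewrite lcomp0m.
have c0 : c = 0.
  have [n [q [p e]]] := in_add_decomp T'add.
  rewrite -[c]lcompm1 -e lcomp_sumr big1 // => i _.
  by rewrite lcompA (g_inj (c \oc q i)) ?lcomp0m // lcompA gc lcomp0m.
have w0 : w = 0 by rewrite -[w]lcompm1 -z'z lcompA -cE c0 (susp0 tri) lcomp0m.
have [s vs] : exists s, v \oc s = lidm Z.
  by apply: (dist_lift tri (dist_rotate tri d)); rewrite w0 lcomp0m.
have s0 : s = 0.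
  have [s' es] := susp_full tri (s \oc z').
  rewrite -[s]lcompm1 -z'z lcompA -es.
  by rewrite (in_add_hom0 T'add tilting_rigid s') (susp0 tri) lcomp0m.
have v0 : v = 0 by rewrite -[v]lcomp1m -vs s0 lcompm0 lcomp0m.
have [g' gg'] : exists g', g \oc g' = lidm (Sigma (Sigma T) : C).
  by apply: (dist_lift tri d); rewrite v0 lcomp0m.
exists g, g'; split=> //; apply/eqP; rewrite -subr_eq0; apply/eqP/g_inj.
by rewrite lcompBr lcompA gg' lcomp1m lcompm1 subrr.
Qed.

(** It suffices to treat [T] in place of [W]. Since [T] is isomorphic to its double suspension, a
    morphism from Sigma T to T becomes the suspension of one from T to Sigma T, which is 0. *)
Lemma hom_susp_tilting W (f : lhom (Sigma T : C) W) : in_add T W -> f = 0.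
Proof.
move=> WT; apply: (in_add_hom0r WT) => {}f.
have [g [g' [_ g'g _]]] := double_susp_iso.
have [f' ef] := susp_full tri (g \oc f).
by rewrite -[f]lcomp1m -g'g -lcompA -ef (tilting_rigid f') (susp0 tri) lcompm0.
Qed.

(** If the identity of [W] is the sum of the [q i \oc p i], naturality forces the value at [W] to be
    the sum of the [S2 (q i) \oc g \oc p i]. Since [g] commutes with End T, these maps are natural
    in [W], and the same formula with [g'] inverts them. *)
Lemma double_susp_in_add W1 W0 (u : lhom W1 W0) : in_add T W1 -> in_add T W0 ->
  exists (g1 : lhom W1 (Sigma (Sigma W1) : C)) (k1 : lhom (Sigma (Sigma W1) : C) W1)
    (g0 : lhom W0 (Sigma (Sigma W0) : C)) (k0 : lhom (Sigma (Sigma W0) : C) W0),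
  [/\ k1 \oc g1 = lidm W1, g1 \oc k1 = lidm (Sigma (Sigma W1) : C),
      k0 \oc g0 = lidm W0, g0 \oc k0 = lidm (Sigma (Sigma W0) : C) &
      g0 \oc u = S2 u \oc g1].
Proof.
have [g [g' [gN g'g gg']]] := double_susp_iso.
have S2sum (I : finType) X Y (F : I -> lhom X Y) : S2 (\sum_i F i) = \sum_i S2 (F i).
  by apply: (big_morph (fun f => S2 f)) => [x y|]; rewrite ?(suspD tri) ?(susp0 tri).
have S2comp X Y Z (f : lhom Y Z) (h : lhom X Y) : S2 (f \oc h) = S2 f \oc S2 h.
  by rewrite !susp_comp.
pose un W n (q : 'I_n -> lhom T W) (p : 'I_n -> lhom W T) :=
  \sum_i (S2 (q i) \oc g \oc p i).
pose ku W n (q : 'I_n -> lhom T W) (p : 'I_n -> lhom W T) :=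
  \sum_i (q i \oc g' \oc S2 (p i)).
have unl W n (q : 'I_n -> lhom T W) p (f : lhom T W) : \sum_i (q i \oc p i) = lidm W ->
    un _ _ q p \oc f = S2 f \oc g.
  move=> e; rewrite -[f in RHS]lcomp1m -e !lcomp_suml S2sum lcomp_suml.
  by apply: eq_bigr => i _; rewrite -[LHS]lcompA -[LHS]lcompA gN !S2comp !lcompA.
have unr W n (q : 'I_n -> lhom T W) p (f : lhom W T) : \sum_i (q i \oc p i) = lidm W ->
    S2 f \oc un _ _ q p = g \oc f.
  move=> e; rewrite -[f in RHS]lcompm1 -e !lcomp_sumr.
  by apply: eq_bigr => i _; rewrite (lcompA f) [RHS]lcompA gN S2comp !lcompA.
have kug W n (q : 'I_n -> lhom T W) p : \sum_i (q i \oc p i) = lidm W ->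
    ku _ _ q p \oc un _ _ q p = lidm W.
  move=> e; rewrite lcomp_suml -[RHS]e; apply: eq_bigr => i _.
  by rewrite -lcompA (unr _ _ _ _ _ e) lcompA -(lcompA (q i)) g'g lcompm1.
have ugk W n (q : 'I_n -> lhom T W) p : \sum_i (q i \oc p i) = lidm W ->
    un _ _ q p \oc ku _ _ q p = lidm (Sigma (Sigma W) : C).
  move=> e; rewrite lcomp_sumr -!susp_id -e S2sum; apply: eq_bigr => i _.
  by rewrite !lcompA (unl _ _ _ _ _ e) -(lcompA (S2 _) g) gg' lcompm1 S2comp.
have unN W W' n n' (q : 'I_n -> lhom T W) p (q' : 'I_n' -> lhom T W') p' (f : lhom W W') :
    \sum_i (q i \oc p i) = lidm W -> \sum_i (q' i \oc p' i) = lidm W' ->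
    un _ _ q' p' \oc f = S2 f \oc un _ _ q p.
  move=> e e'; rewrite -[f in LHS]lcompm1 -e !lcomp_sumr; apply: eq_bigr => i _.
  by rewrite !lcompA -(lcompA _ f) (unl _ _ _ _ _ e') S2comp.
move=> /in_add_decomp[n1 [q1 [p1 e1]]] /in_add_decomp[n0 [q0 [p0 e0]]].
exists (un _ _ q1 p1), (ku _ _ q1 p1), (un _ _ q0 p0), (ku _ _ q0 p0).
by split; [exact: kug | exact: ugk | exact: kug | exact: ugk | exact: unN].
Qed.

(** Let V be the cone of an add T-approximation [v] of [X]. A morphism from T to V dies in Sigma W0,
    so it comes from [X], then from [W0] through [v], and is 0. Hence V is the suspension of an
    object [W1] on which the cluster-tilting condition holds. *)
Lemma cluster_tilting_triangle X : exists W1 W0 (u : lhom W1 W0) (v : lhom W0 X)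
    (w : lhom X (Sigma W1 : C)),
  [/\ dist u v w, in_add T W1, in_add T W0 & generated_by T v].
Proof.
have [W0 [v [W0T vT]]] := approximation T X add.
have [V [m [n d]]] := tri_cone tri v.
have TV (f : lhom T V) : f = 0.
  have nf := iffLR (T_tilting W0) W0T (n \oc f).
  have [f' <-] := dist_lift tri (dist_rotate tri d) nf.
  by have [f'' <-] := vT f'; rewrite lcompA (dist_comp0 tri d) lcomp0m.
have [W1 [z [z' [z'z zz']]]] := susp_ess_surj tri V.
have W1T : in_add T W1.
  by apply/(T_tilting W1) => f; rewrite -[f]lcomp1m -zz' -lcompA (TV (z' \oc f)) lcompm0.
(* The sign anticipates the map [- S u] that rotation produces. *)
have [u uE] := susp_full tri (- (n \oc z')).
exists W1, W0, u, v, (z \oc m); split=> //.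
apply: (dist_unrotate tri); apply: (tri_iso tri) d.
- by exists (lidm W0); split; apply: lcomp1m.
- by exists (lidm X); split; apply: lcomp1m.
- by exists z'; split; [exact: z'z | exact: zz'].
- by rewrite lcompm1 lcomp1m.
- by rewrite lcompm1.
by rewrite susp_id lcomp1m uE opprK -lcompA z'z lcompm1.
Qed.

(** The first maps of the triangle over [X] and of its double suspension are isomorphic, hence so
    are their cones. *)
Lemma double_susp_isomorphic X : @isomorphic C (Sigma (Sigma X)) X.
Proof.
have [W1 [W0 [u [v [w [d W1T W0T _]]]]]] := cluster_tilting_triangle X.
have [g1 [k1 [g0 [k0 [a1 a2 a3 a4 sq]]]]] := double_susp_in_add u W1T W0T.
have [f [g [gf fg]]] := dist_iso tri d (dist_susp2 tri d) a1 a2 a3 a4 sq.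
by exists g, f.
Qed.

End ClusterTilting.

(** * The functor Hom(T, -) *)

Section HomModules.
Variables (K : fieldType) (A : fdalg K) (C : linear_category K) (T : C).
Variables (j : A -> endalg T) (j' : endalg T -> A).
Hypotheses (j_lin : linear j) (jM : monoid_morphism j).
Hypotheses (jK : cancel j j') (j'K : cancel j' j).
Implicit Types X Y W : C.

Fact hom_act_linearl X (x : lhom T X) : linear (fun a => x \oc (j a : lhom T T)).
Proof. by move=> k a b; rewrite j_lin lcompDr lcompZr. Qed.
Fact hom_act_linearr X (a : A) : linear (fun x : lhom T X => x \oc (j a : lhom T T)).
Proof. by move=> k x y; rewrite lcompDl lcompZl. Qed.
Fact hom_actM X (a b : A) (x : lhom T X) :
  x \oc (j (a * b) : lhom T T) = (x \oc (j a : lhom T T)) \oc (j b : lhom T T).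
Proof. by rewrite -lcompA; case: jM => _ ->. Qed.
Fact hom_act1 X (x : lhom T X) : x \oc (j 1 : lhom T T) = x.
Proof. by case: jM => -> _; exact: lcompm1. Qed.

Definition hom_mod X : fdmod A :=
  {| mcar := lhom T X; act := fun a x => x \oc (j a : lhom T T);
     act_linearl := @hom_act_linearl X; act_linearr := @hom_act_linearr X;
     actM := @hom_actM X; act1 := @hom_act1 X |}.

Fact hom_map_linear X Y (f : lhom X Y) : linear (fun x : hom_mod X => f \oc x : hom_mod Y).
Proof. by move=> k x y; rewrite lcompDr lcompZr. Qed.
Fact hom_map_act X Y (f : lhom X Y) a (x : hom_mod X) :
  f \oc act (hom_mod X) a x = act (hom_mod Y) a (f \oc x).
Proof. exact: lcompA. Qed.
Definition hom_map X Y (f : lhom X Y) : modhom (hom_mod X) (hom_mod Y) :=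
  mk_modhom (hom_map_linear f) (@hom_map_act X Y f).
Lemma hom_mapE X Y (f : lhom X Y) (x : lhom T X) : hom_map f x = f \oc x.
Proof. exact: mk_modhomE. Qed.

Let j'_lin : linear j'.
Proof. by move=> k x y; apply: (can_inj jK); rewrite j_lin !j'K. Qed.
Let j'M (x y : lhom T T) : j' (x \oc y) = j' x * j' y.
Proof. by apply: (can_inj jK); case: jM => _ ->; rewrite !j'K. Qed.

Lemma modhom_precomp X (M : fdmod A) (h : modhom (hom_mod X) M)
    (x : lhom T X) (y : lhom T T) : h (x \oc y) = act M (j' y) (h x).
Proof. by rewrite -modhomP /= j'K. Qed.

(** A Yoneda argument: [h] is determined by its values on the [q i], because [x] is the sum of the
    [q i \oc (p i \oc x)] and [h] is linear over End T. *)
Lemma hom_map_of_modhom W X (h : modhom (hom_mod W) (hom_mod X)) : in_add T W ->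
  exists f : lhom W X, forall x, f \oc x = h x.
Proof.
move=> /in_add_decomp[n [q [p e]]]; exists (\sum_i ((h (q i) : lhom T X) \oc p i)) => x.
rewrite lcomp_suml -[x in RHS]lcomp1m -e lcomp_suml linear_sum; apply: eq_bigr => i _.
by rewrite /= -!lcompA (modhom_precomp h) /= j'K.
Qed.

Section Covers.
Variables (W : C) (n : nat) (p : 'I_n -> lhom W T) (M : fdmod A) (m : 'I_n -> M).

Fact from_add_linear : linear (fun x : hom_mod W => \sum_i act M (j' (p i \oc x)) (m i)).
Proof.
move=> k x y; rewrite scaler_sumr -big_split; apply: eq_bigr => i _.
by rewrite lcompDr lcompZr j'_lin act_linearl.
Qed.
Fact from_add_act a (x : hom_mod W) :
  \sum_i act M (j' (p i \oc act (hom_mod W) a x)) (m i) =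
  act M a (\sum_i act M (j' (p i \oc x)) (m i)).
Proof.
rewrite act_sum; apply: eq_bigr => i _.
by rewrite /= lcompA j'M jK actM.
Qed.
Definition from_add : modhom (hom_mod W) M := mk_modhom from_add_linear from_add_act.
Lemma from_addE (x : lhom T W) : from_add x = \sum_i act M (j' (p i \oc x)) (m i).
Proof. exact: mk_modhomE. Qed.
End Covers.

(** The [q i] generate Hom(T, W), and lifting their images suffices: the [p i] turn any choice of
    such lifts into a homomorphism. *)
Lemma hom_mod_projective W : in_add T W -> projective (hom_mod W).
Proof.
move=> /in_add_decomp[n [q [p e]]] M N s f ssurj.
pose m i := sval (cid (ssurj (f (q i)))).
have mE i : s (m i) = f (q i) := svalP (cid (ssurj (f (q i)))).
exists (from_add p m); apply: modhom_eq => x; rewrite mcompE from_addE linear_sum.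
rewrite -[x in RHS]lcomp1m -e lcomp_suml linear_sum; apply: eq_bigr => i _.
by rewrite /= modhomP mE -lcompA modhom_precomp.
Qed.

Lemma hom_mod_cover (M : fdmod A) : is_additive C ->
  exists W (s : modhom (hom_mod W) M), in_add T W /\ msurjective s.
Proof.
move=> add; have [W WT] := add 'I_(\dim {:M}) (fun=> T).
have [i [p [pi pj _]]] := WT.
exists W, (from_add p (fun k => (vbasis {:M})`_k)).
split=> [|y]; first exact: biproduct_in_add WT.
exists (\sum_(k < \dim {:M}) coord (vbasis {:M}) k y *: i k).
rewrite from_addE [RHS](coord_vbasis (memvf y)); apply: eq_bigr => k _.
have -> : p k \oc (\sum_(l < \dim {:M}) coord (vbasis {:M}) l y *: i l) =
    coord (vbasis {:M}) k y *: lidm T.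
  rewrite lcomp_sumr (bigD1 k) //= lcompZr pi big1 ?addr0 // => l lk.
  by rewrite lcompZr pj // scaler0.
have j'1 : j' (lidm T) = 1 by apply: (can_inj jK); rewrite j'K; case: jM => ->.
have j'Z z : j' (z *: lidm T) = z *: (1 : A).
  have j'0 : j' 0 = 0 by have := j'_lin (-1) 0 0; rewrite scaler0 addr0 scaleN1r addNr.
  by have := j'_lin z (lidm T) 0; rewrite j'0 !addr0 j'1.
rewrite j'Z; set v := _`_k; set c := coord _ _ _.
have a0 : act M 0 v = 0.
  by have := act_linearl v (-1) 0 0; rewrite scaler0 addr0 scaleN1r addNr.
by have := act_linearl v c 1 0; rewrite !addr0 a0 addr0 act1.
Qed.
End HomModules.

(** * Projective resolutions from cluster-tilting triangles *)

Section TiltingResolutions.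
Variables (K : fieldType) (A : fdalg K) (C : linear_category K).
Variables (Sigma : functor C C) (dist : triangles Sigma) (T : C).
Hypotheses (A_symmetric : symmetric_algebra A) (tri : is_triangulated dist).
Hypotheses (CY : has_2CY_duality Sigma) (T_tilting : cluster_tilting Sigma T).
Hypothesis A_end : algebra_iso A (endalg T).
Variables (j : A -> endalg T) (j' : endalg T -> A).
Hypotheses (j_lin : linear j) (jM : monoid_morphism j).
Hypotheses (jK : cancel j j') (j'K : cancel j' j).
Implicit Types X Y Z W : C.
Notation S := (fmapl Sigma).
Notation S2 f := (S (S f)).
Notation F := (hom_mod j_lin jM).
Notation Fm := (hom_map j_lin jM).

(** On an approximation [v] of [X] by [W0] in add T, the map [h] is represented by some [c]. It
    kills [W1], since [v \oc u = 0] can be tested on morphisms from [T]; so [c] factors through [v],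
    and morphisms from [T] to [X] all lift along [v]. *)
Lemma hom_map_full X Y (h : modhom (F X) (F Y)) : exists f : lhom X Y, forall x, f \oc x = h x.
Proof.
have [W1 [W0 [u [v [w [d W1T W0T vT]]]]]] := cluster_tilting_triangle tri T_tilting X.
have [c cE] := hom_map_of_modhom j'K (mcomp h (Fm v)) W0T.
have [f fv] : exists f, f \oc v = c.
  apply: (dist_factor tri d); have [n [q [p e]]] := in_add_decomp W1T.
  rewrite -[LHS]lcompm1 -e lcomp_sumr big1 // => i _.
  rewrite lcompA -(lcompA c) cE mcompE hom_mapE lcompA (dist_comp0 tri d).
  by rewrite lcomp0m linear0 lcomp0m.
exists f => x; have [y <-] := vT x; rewrite lcompA fv cE.
by rewrite mcompE hom_mapE.
Qed.

(** An add T-presentation of Sigma Y, rotated so that [Y] comes first; under Hom(T, -) it yields two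
    syzygy steps. *)
Record tilting_triangle Y := TiltingTriangle {
  tt1 : C; tt0 : C;
  tta : lhom Y tt1; ttb : lhom tt1 tt0; ttc : lhom tt0 (Sigma Y : C);
  tt_dist : dist tta ttb ttc;
  tt1_in : in_add T tt1;
  tt0_in : in_add T tt0;
  ttc_gen : generated_by T ttc
}.

Lemma tilting_triangle_exists Y : tilting_triangle Y.
Proof.
have /cid[W1 /cid[W0 /cid[b /cid[c /cid[w [d W1T W0T cT]]]]]] :=
  cluster_tilting_triangle tri T_tilting (Sigma Y).
have /cid[a aE] := susp_full tri (- w).
apply: (@TiltingTriangle Y W1 W0 a b c) => //.
by apply: (dist_unrotate tri); rewrite aE opprK.
Qed.

Section Resolution.
Variables (Y : C) (t : tilting_triangle Y).
Let a := tta t. Let b := ttb t. Let c := ttc t.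

Definition tilting_sq1 : syzygy_seq (F (Sigma Y)) (ker_mod (Fm c)).
Proof.
apply: (@SyzygySeq _ _ (F (Sigma Y)) (ker_mod (Fm c)) (F (tt0 t)) (ker_incl _) (Fm c)).
- exact: (hom_mod_projective jK j'K (tt0_in t)).
- by move=> x; have [y <-] := ttc_gen t x; exists y; rewrite hom_mapE.
- exact: ker_incl_inj.
- exact: ker_inclP.
- move=> x cx; have xk : x \in lker (Fm c) by rewrite memv_ker cx.
  by exists (vsproj (lker (Fm c)) x); rewrite ker_inclE vsprojK.
Defined.

Fact tilting_cb (x : F (tt1 t)) : Fm c (Fm b x) = 0.
Proof.
rewrite hom_mapE [X in c \oc X]hom_mapE lcompA.
by rewrite (dist_comp0 tri (dist_rotate tri (tt_dist t))) lcomp0m.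
Qed.

Definition tilting_out : modhom (F (tt1 t)) (ker_mod (Fm c)) :=
  sval (cid (ker_factor tilting_cb)).
Lemma tilting_outE x : ker_incl (Fm c) (tilting_out x) = b \oc x.
Proof. by rewrite -mcompE (svalP (cid (ker_factor tilting_cb))) hom_mapE. Qed.

Definition tilting_sq2 : syzygy_seq (ker_mod (Fm c)) (F Y).
Proof.
apply: (@SyzygySeq _ _ (ker_mod (Fm c)) (F Y) (F (tt1 t)) (Fm a) tilting_out).
- exact: (hom_mod_projective jK j'K (tt1_in t)).
- move=> x; have cx : c \oc (ker_incl (Fm c) x : lhom T (tt0 t)) = 0.
    by rewrite -(hom_mapE j_lin jM) ker_inclP.
  have [y ey] := dist_lift tri (dist_rotate tri (tt_dist t)) cx.
  by exists y; apply: ker_incl_inj; rewrite tilting_outE.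
- move=> x y; rewrite !hom_mapE => /eqP; rewrite -subr_eq0 -lcompBr => /eqP axy.
  (* If [a] kills [x - y], then the suspension of [x - y] factors through a morphism from Sigma T to
     the add T-object [tt0 t], and such a morphism is 0. *)
  have [|f ef] := dist_lift tri (dist_rotate tri (dist_rotate tri (tt_dist t)))
      (f := S (x - y)).
    by rewrite lcompNl -susp_comp axy (susp0 tri) oppr0.
  apply/eqP; rewrite -subr_eq0; apply/eqP/(susp_inj tri).
  rewrite -ef (hom_susp_tilting A_symmetric tri CY T_tilting A_end f (tt0_in t)).
  by rewrite lcompm0 (susp0 tri).
- move=> x; apply: ker_incl_inj; rewrite tilting_outE hom_mapE lcompA.
  by rewrite (dist_comp0 tri (tt_dist t)) lcomp0m linear0.
- move=> x bx; have bx0 : b \oc (x : lhom T _) = 0.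
    by rewrite -tilting_outE bx linear0.
  by have [y ey] := dist_lift tri (tt_dist t) bx0; exists y; rewrite hom_mapE.
Defined.
End Resolution.

(** The suspension of [f] lifts to the approximations and then to a morphism of the whole triangles
    with [f] itself at the start. So the map induced by F(Sigma f) on second syzygies can be taken
    to be exactly F f. *)
Lemma tilting_lift Y Y' (t : tilting_triangle Y) (t' : tilting_triangle Y')
    (f : lhom Y Y') : exists n,
  sq_lift (tilting_sq1 t) (tilting_sq1 t') (Fm (S f)) n /\
  sq_lift (tilting_sq2 t) (tilting_sq2 t') n (Fm f).
Proof.
have [k0 ck] := in_add_lift (tt0_in t) (@ttc_gen _ t') (S f \oc ttc t).
have [h [h1 h2]] := tri_complete tri (dist_rotate tri (dist_rotate tri (tt_dist t)))
  (dist_rotate tri (dist_rotate tri (tt_dist t'))) (esym ck).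
have [k1 k1E] := susp_full tri h.
have ka : k1 \oc tta t = tta t' \oc f.
  apply: (susp_inj tri); apply: oppr_inj; rewrite !susp_comp k1E.
  by rewrite -lcompNr h1 lcompNl.
have kb : k0 \oc ttb t = ttb t' \oc k1.
  apply: (susp_inj tri); apply: oppr_inj; rewrite !susp_comp k1E.
  by rewrite -lcompNr h2 lcompNl.
have [x|n nE] := @ker_factor _ _ _ _ (Fm (ttc t')) _ (mcomp (Fm k0) (ker_incl (Fm (ttc t)))).
  rewrite mcompE !hom_mapE lcompA ck -lcompA.
  by rewrite -(hom_mapE j_lin jM (ttc t)) ker_inclP lcompm0.
have nE' x : ker_incl (Fm (ttc t')) (n x) = Fm k0 (ker_incl (Fm (ttc t)) x).
  by rewrite -mcompE nE mcompE.
exists n; split.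
  exists (Fm k0); split=> x; last exact: nE'.
  by rewrite /= !hom_mapE !lcompA ck.
exists (Fm k1); split=> x; last by rewrite /= !hom_mapE !lcompA ka.
apply: ker_incl_inj; rewrite [LHS]tilting_outE [RHS]nE' !hom_mapE.
by rewrite tilting_outE !lcompA kb.
Qed.

(** A presentation of [M] by modules F W1 and F W0 comes from some [u] from W1 to W0. As Hom(T,
    Sigma W1) = 0, F of the cone of [u] is the cokernel, which is [M]. *)
Lemma hom_mod_ess_surj (M : fdmod A) : exists X (s : modhom (F X) M),
  minjective s /\ msurjective s.
Proof.
have add := tri_additive tri.
have [W0 [p0 [W0T p0s]]] := hom_mod_cover j_lin jM jK j'K M add.
have [W1 [p1 [W1T p1s]]] := hom_mod_cover j_lin jM jK j'K (ker_mod p0) add.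
have [u uE] := hom_map_of_modhom j'K (mcomp (ker_incl p0) p1) W1T.
have [X [v [w d]]] := tri_cone tri u.
have vs : msurjective (Fm v).
  move=> x; have [y <-] := dist_lift tri (dist_rotate tri d)
    (iffLR (T_tilting W1) W1T (w \oc x)).
  by exists y; rewrite hom_mapE.
have [x|s [si ss _]] := cokernel_unique vs p0s.
  rewrite hom_mapE; split=> [vx|px].
    by have [y <-] := dist_lift tri d vx; rewrite uE mcompE ker_inclP.
  have xk : x \in lker p0 by rewrite memv_ker px.
  have [y ey] := p1s (vsproj (lker p0) x).
  have -> : x = u \oc (y : lhom T W1).
    by rewrite uE mcompE ey ker_inclE vsprojK.
  by rewrite lcompA (dist_comp0 tri d) lcomp0m.
by exists X, s.
Qed.

(** * Closing up the resolution by the double suspension *)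

Section DoubleSuspension.
Variables (g : lhom T (Sigma (Sigma T) : C)) (g' : lhom (Sigma (Sigma T) : C) T).
Hypothesis gN : forall a : lhom T T, g \oc a = S2 a \oc g.
Hypotheses (g'g : g' \oc g = lidm T) (gg' : g \oc g' = lidm (Sigma (Sigma T) : C)).

Fact double_susp_linear Z :
  linear (fun x : F Z => S2 (x : lhom T Z) \oc g : F (Sigma (Sigma Z))).
Proof. by move=> k x y; rewrite !(suspZD tri) lcompDl lcompZl. Qed.
Fact double_susp_act Z a (x : F Z) : S2 (act (F Z) a x : lhom T Z) \oc g =
  act (F (Sigma (Sigma Z))) a (S2 (x : lhom T Z) \oc g).
Proof. by rewrite /= !susp_comp -!lcompA gN. Qed.
Definition double_susp_map Z : modhom (F Z) (F (Sigma (Sigma Z))) :=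
  mk_modhom (@double_susp_linear Z) (@double_susp_act Z).
Lemma double_susp_mapE Z (x : lhom T Z) : double_susp_map Z x = S2 x \oc g.
Proof. exact: mk_modhomE. Qed.

Lemma double_susp_map_inj Z : minjective (double_susp_map Z).
Proof.
move=> x y; rewrite !double_susp_mapE => /(congr1 (fun h => h \oc g')).
by rewrite -!lcompA gg' !lcompm1 => /(susp_inj tri)/(susp_inj tri).
Qed.

Lemma double_susp_map_surj Z : msurjective (double_susp_map Z).
Proof.
move=> y; have [x1 e1] := susp_full tri ((y : lhom T _) \oc g').
have [x e] := susp_full tri x1.
by exists x; rewrite double_susp_mapE e e1 -lcompA g'g lcompm1.
Qed.

(** Identifies [M] both with F(Sigma^2 Z) and with F Z, the two identifications being matched by
    [double_susp_map]. This is what allows one module at both ends of a resolution, compatibly with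
    maps. *)
Record desuspension (M : fdmod A) := Desuspension {
  ds_ob : C;
  ds_map : modhom (F (Sigma (Sigma ds_ob))) M;
  ds_inv : modhom M (F ds_ob);
  ds_mapK : forall x, ds_map (double_susp_map ds_ob (ds_inv x)) = x;
  ds_invK : forall x, ds_inv (ds_map (double_susp_map ds_ob x)) = x;
}.

Lemma desuspension_exists M : desuspension M.
Proof.
have /cid[X /cid[s [si ss]]] := hom_mod_ess_surj M.
have /cid[Y /cid[f /cid[f' [f'f ff']]]] := susp_ess_surj tri X.
have /cid[Z /cid[h /cid[h' [h'h hh']]]] := susp_ess_surj tri Y.
pose k := mcomp (mcomp s (Fm (f' \oc S h'))) (double_susp_map Z).
have kE x : k x = s (f' \oc (S h' \oc (double_susp_map Z x : lhom T _))).
  by rewrite !mcompE hom_mapE lcompA.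
have ki : minjective k.
  move=> x y; rewrite !kE => /si /(congr1 (fun t => f \oc t)).
  rewrite !lcompA ff' !lcomp1m => /(congr1 (fun t => S h \oc t)).
  by rewrite !lcompA -susp_comp hh' susp_id !lcomp1m => /double_susp_map_inj.
have ks : msurjective k.
  move=> y; have [x <-] := ss y.
  have [z ez] := double_susp_map_surj (S h \oc (f \oc (x : lhom T X))).
  exists z; rewrite kE ez !(lcompA (S h')) -susp_comp h'h susp_id lcomp1m.
  by rewrite lcompA f'f lcomp1m.
have /cid[k' [k'k kk']] := modhom_inverse ki ks.
exists Z (mcomp s (Fm (f' \oc S h'))) k' => x.
  by rewrite -[RHS]kk' [RHS]mcompE.
by rewrite -[RHS]k'k [in RHS]mcompE.
Qed.

Section PeriodicResolution.
Variables (M : fdmod A) (D : desuspension M).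
Let Z := ds_ob D.

Fact ds_map_inj : minjective (ds_map D).
Proof.
move=> x y; have [x' <-] := double_susp_map_surj x; have [y' <-] := double_susp_map_surj y.
by move/(congr1 (ds_inv D)); rewrite !ds_invK => ->.
Qed.
Fact ds_map_surj : msurjective (ds_map D).
Proof. by move=> y; eexists; exact: ds_mapK. Qed.
Fact ds_inv_inj : minjective (ds_inv D).
Proof. by move=> x y e; rewrite -[x](ds_mapK D) e ds_mapK. Qed.
Fact ds_inv_surj : msurjective (ds_inv D).
Proof. by move=> y; eexists; exact: ds_invK. Qed.

(** The triangle for Sigma Z leads from F(Sigma^2 Z) to F(Sigma Z), the one for Z from there to F Z;
    both ends are relabelled as [M]. *)
Definition tilting_r4 : resolution4 M M :=
  let t' := tilting_triangle_exists (Sigma Z) in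
  let t := tilting_triangle_exists Z in
  Resolution4
    (sq_conj (tilting_sq1 t') ds_map_inj ds_map_surj
      (b := mid _) (@mid_inj K A _) (@mid_surj K A _))
    (tilting_sq2 t') (tilting_sq1 t)
    (sq_conj (tilting_sq2 t) (a := mid _) (@mid_inj K A _) (@mid_surj K A _)
      ds_inv_inj ds_inv_surj).
End PeriodicResolution.

(** By fullness of F and of Sigma, [f] corresponds to F(Sigma^2 phi) at the start. [tilting_lift],
    used twice, produces F phi at the end, and naturality of [double_susp_map] turns this back into
    [f]. *)
Lemma tilting_r4_lift M N (D : desuspension M) (D' : desuspension N) (f : modhom M N) :
  r4_lift (tilting_r4 D) (tilting_r4 D') f f.
Proof.
have [h hK] := modhom_inverse (@ds_map_inj _ D') (@ds_map_surj _ D').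
have [phi2 phi2E] := hom_map_full (mcomp h (mcomp f (ds_map D))).
have [phi1 phi1E] := susp_full tri phi2; have [phi phiE] := susp_full tri phi1.
have fE x : ds_map D' (Fm (S (S phi)) x) = f (ds_map D x).
  by rewrite hom_mapE phiE phi1E phi2E !mcompE; case: hK.
have [n1 [l1 l2]] := tilting_lift (tilting_triangle_exists (Sigma (ds_ob D)))
  (tilting_triangle_exists (Sigma (ds_ob D'))) (S phi).
have [n2 [l3 l4]] := tilting_lift (tilting_triangle_exists (ds_ob D))
  (tilting_triangle_exists (ds_ob D')) phi.
exists n1, (Fm (S phi)), n2; split=> //.
  by apply: sq_conj_lift l1 _ _ => x; rewrite ?midE.
apply: sq_conj_lift l4 _ _ => x; rewrite ?midE //.
rewrite -[x in LHS](ds_mapK D) -fE -[RHS](@ds_invK _ D'); congr (ds_inv _ (ds_map _ _)).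
by rewrite !hom_mapE !double_susp_mapE !susp_comp lcompA.
Qed.

End DoubleSuspension.
End TiltingResolutions.

Theorem proposition1p4
    (K : fieldType) (A : fdalg K)
    (C : linear_category K) (Sigma : functor C C) (dist : triangles Sigma)
    (T : C)
    (A_symmetric : symmetric_algebra A)
    (C_2CY : is_2CY_triangulated dist)
    (T_tilting : cluster_tilting Sigma T)
    (A_end : algebra_iso A (endalg T)) :
  [/\ (* (a) *)
      forall S : presentations A,
        functor_iso (functor_iter 4 (syzygy_functor S))
                    (functor_id (stable_category A)) /\
        (forall M : fdmod A, ~ projective M ->
           exists r : nat, has_syzygy_period S M r /\ (r %| 4)%N),
      (* (b) *)
      forall X : C, isomorphic (Sigma (Sigma X)) X
    & (* (c) *)
      forall (Q : quiver) (rho : arrow Q -> completed_path_algebra K Q)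
             (phi : completed_path_algebra K Q -> A),
        is_hyperpotential rho -> jacobian_presentation rho phi ->
        (rigid phi <-> semisimple_algebra A)].
Proof.
have [tri _ CY] := C_2CY.
split=> [S|X|Q rho phi _ phiP]; last first.
- split; [exact: rigid_semisimple phiP A_symmetric | exact: semisimple_rigid phiP].
- exact: (double_susp_isomorphic A_symmetric tri CY T_tilting A_end).
have per : functor_iso (functor_iter 4 (syzygy_functor S)) (functor_id (stable_category A)).
  have [g [g' [gN g'g gg']]] := double_susp_iso A_symmetric tri CY T_tilting A_end.
  have [j [j_lin jM [j' jK j'K]]] := A_end.
  pose D M := desuspension_exists tri T_tilting j_lin jM jK j'K gN g'g gg' M.
  pose R M := tilting_r4 A_symmetric CY T_tilting A_end jK j'K g'g (D M).
  have RP M N (f : modhom M N) : r4_lift (R M) (R N) f f by apply: tilting_r4_lift.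
  exact: (syzygy_periodic4 S RP).
by split=> // M _; exact: periodic4_period.
Qed.
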